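(* Let $n\ge 3$ and let $(W_n',S_n')$ be a Coxeter system of type $D_n$ (with $D_3=A_3$). Let $\mathrm{LL}(W_n')$ denote the Loewy length of the Solomon descent algebra $\Sigma(W_n')$. Then: (a) If $n$ is even, then $\mathrm{LL}(W_n')=\left\lceil\frac{n}{2}\right\rceil$. (b) If $n$ is odd, then $\mathrm{LL}(W_n')\ge\frac{n+3}{2}$.
   Context: Let $(W,S)$ be a finite Coxeter system with length function $\ell$. For $I\subset S$, set $X_I=\{w\in W : \ell(ws)>\ell(w)\ \text{for all } s\in I\}$ and $x_I=\sum_{w\in X_I} w\in\mathbb{Q}W$. The Solomon descent algebra is $\Sigma(W)=\bigoplus_{I\subset S}\mathbb{Q}x_I$; it is a unital subalgebra of the group algebra $\mathbb{Q}W$, with basis $(x_I)_{I\subset S}$ (Solomon). The Loewy length of a finite dimensional algebra $A$ is the smallest integer $k\ge 1$ such that $(\mathrm{Rad}\,A)^k=0$, where $\mathrm{Rad}\,A$ is the (Jacobson) radical. *)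

(* Defs.v *)
From HB Require Import structures.
From mathcomp Require Import all_boot all_order all_algebra all_fingroup all_field.
From mathcomp Require Import boolp.

Set Implicit Arguments.
Unset Strict Implicit.
Unset Printing Implicit Defensive.

Import GRing.Theory.

Local Open Scope ring_scope.

(* The value is 0 when P holds nowhere. *)
Definition least (P : pred nat) : nat :=
  if pselect (exists k, P k) is left exP then ex_minn exP else 0%N.

Lemma leastP (P : pred nat) :
  (exists k, P k) -> P (least P) /\ (forall k, P k -> (least P <= k)%N).
Proof.
by move=> exP; rewrite /least; case: pselect => // h; case: ex_minnP => m; split.
Qed.

Section Coxeter.
Variable gT : finGroupType.
Implicit Types (S I : {set gT}) (w : gT).
Local Open Scope group_scope.

(* The last clause is the universal property of the group presented by the
   generators S and the relations (s t)^m(s,t) = 1, where m(s,t) is the order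
   of s t; for s = t the relation reads s^2 = 1. The target group H may be
   infinite. *)
Definition coxeter_system S : Prop :=
  [/\ <<S>> = [set: gT],
      {in S, forall s, #[s] = 2%N}
    & forall (H : groupType) (f : gT -> H),
        {in S &, forall s t, (f s * f t) ^+ #[s * t] = 1} ->
        exists2 phi : gT -> H,
          {morph phi : x y / x * y} & {in S, phi =1 f}].

(* The nodes 0 - 1 - ... - (n-2) form a path, and n-1 is attached to n-3. *)
Definition coxD_edge (n i j : nat) : bool :=
  ((j == i.+1) && (j.+1 < n)%N) || ((i.+3 == n) && (j.+1 == n)).

Definition coxD_mx (n i j : nat) : nat :=
  (if i == j then 1 else if coxD_edge n i j || coxD_edge n j i then 3 else 2)%N.

Definition coxeter_type_D (n : nat) S : Prop :=
  exists s : 'I_n -> gT,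
    [/\ injective s, S = [set s i | i : 'I_n]
      & forall i j, #[s i * s j] = coxD_mx n i j].

(* S ^+ k is the set of all products of k elements of S. *)
Definition cox_length S w : nat := least (fun k => w \in S ^+ k).

Definition X_set S I : {set gT} :=
  [set w | [forall s in I, (cox_length S w < cox_length S (w * s))%N]].

End Coxeter.

(* A copy of {ffun gT -> F} that carries the convolution product instead of
   the pointwise one; F^o is F viewed as a vector space over itself. *)
Definition group_algebra (F : fieldType) (gT : finGroupType) : Type :=
  {ffun gT -> F^o}.

Section GroupAlgebra.
Variables (F : fieldType) (gT : finGroupType).
Local Notation A := (group_algebra F gT).

HB.instance Definition _ := Vector.copy A {ffun gT -> F^o}.

Definition galg_of (w : gT) : A := [ffun g => (g == w)%:R : F^o].

Definition galg_mul (u v : A) : A :=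
  [ffun g => (\sum_h (u h : F) * v (h^-1 * g)%g) : F^o].

Fact galg_mulA : associative galg_mul.
Proof.
move=> u v w; apply/ffunP=> g; rewrite !ffunE.
under eq_bigr => h _ do rewrite ffunE big_distrr /=.
under [RHS]eq_bigr => h _ do rewrite ffunE big_distrl /=.
rewrite [RHS]exchange_big /=; apply: eq_bigr => h _.
rewrite [RHS](reindex_inj (mulgI h)) /=; apply: eq_bigr => k _.
by rewrite mulrA mulKg invMg mulgA.
Qed.

Fact galg_mul1 : left_id (galg_of 1%g) galg_mul.
Proof.
move=> u; apply/ffunP=> g; rewrite !ffunE (bigD1 1%g) //= big1 => [|h /negPf h1].
  by rewrite ffunE eqxx invg1 mul1g mul1r addr0.
by rewrite ffunE h1 mul0r.
Qed.

Fact galg_mulr1 : right_id (galg_of 1%g) galg_mul.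
Proof.
move=> u; apply/ffunP=> g; rewrite !ffunE (bigD1 g) //= big1 => [|h hg].
  by rewrite ffunE mulVg eqxx mulr1 addr0.
by rewrite ffunE -eq_mulVg1 (negPf hg) mulr0.
Qed.

Fact galg_mulDl : left_distributive galg_mul +%R.
Proof.
move=> u v w; apply/ffunP=> g; rewrite !ffunE -big_split /=.
by apply: eq_bigr => h _; rewrite ffunE mulrDl.
Qed.

Fact galg_mulDr : right_distributive galg_mul +%R.
Proof.
move=> u v w; apply/ffunP=> g; rewrite !ffunE -big_split /=.
by apply: eq_bigr => h _; rewrite ffunE mulrDr.
Qed.

Fact galg_1neq0 : galg_of 1%g != 0.
Proof. by apply/eqP=> /ffunP/(_ 1%g)/eqP; rewrite !ffunE eqxx oner_eq0. Qed.

HB.instance Definition _ := GRing.Zmodule_isNzRing.Build A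
  galg_mulA galg_mul1 galg_mulr1 galg_mulDl galg_mulDr galg_1neq0.

Fact galg_scaleAl (a : F) (u v : A) : a *: (u * v) = (a *: u) * v.
Proof.
apply/ffunP=> g; rewrite !ffunE scaler_sumr.
by apply: eq_bigr => h _; rewrite ffunE /= scalerAl.
Qed.

HB.instance Definition _ := GRing.Lmodule_isLalgebra.Build F A galg_scaleAl.

Fact galg_scaleAr (a : F) (u v : A) : a *: (u * v) = u * (a *: v).
Proof.
apply/ffunP=> g; rewrite !ffunE scaler_sumr.
by apply: eq_bigr => h _; rewrite ffunE /= scalerAr.
Qed.

HB.instance Definition _ := GRing.Lalgebra_isAlgebra.Build F A galg_scaleAr.
HB.instance Definition _ := Algebra_isFalgebra.Build F A.

Lemma galg_ofM (v w : gT) : galg_of (v * w)%g = galg_of v * galg_of w.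
Proof.
apply/ffunP=> g; rewrite !ffunE (bigD1 v) //= big1 => [|h /negPf hv].
  by rewrite !ffunE eqxx mul1r addr0 (canF_eq (mulKVg v)).
by rewrite ffunE hv mul0r.
Qed.

End GroupAlgebra.

(* In this section A is meant to be a subalgebra of aT containing 1, so that
   its left ideals are exactly the subspaces U of A with A U inside U. *)
Section Radical.
Variables (K : fieldType) (aT : falgType K).
Implicit Types (A U V R : {vspace aT}).

Definition left_ideal A U : Prop := (U <= A)%VS /\ (A * U <= U)%VS.

Definition maximal_left_ideal A U : Prop :=
  [/\ left_ideal A U, U <> A
    & forall V, left_ideal A V -> (U <= V)%VS -> V = U \/ V = A].

Fact jacobson_exists A : exists R, forall x : aT,
  x \in R <-> x \in A /\ forall U, maximal_left_ideal A U -> x \in U.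
Proof.
pose P V := exists R, forall x : aT,
  x \in R <-> x \in V /\ forall U, maximal_left_ideal A U -> x \in U.
rewrite -/(P A); have [m] := ubnP (\dim A).
suff main V : (\dim V < m)%N -> P V by exact: main.
elim: m V => // m IHm V ltVm.
have [[U maxU nVU]|noU] :=
    pselect (exists2 U, maximal_left_ideal A U & ~~ (V <= U)%VS).
  have [|R RP] := IHm (V :&: U)%VS.
    rewrite -ltnS (leq_trans _ ltVm) // ltnS.
    rewrite ltn_neqAle dimvS ?capvSl // andbT.
    apply: contra nVU => /eqP eqd; apply/capv_idPl/eqP.
    by rewrite eqEdim capvSl eqd leqnn.
  exists R => x; rewrite RP memv_cap; split=> [[/andP[xV _] ?]|[xV h]].
    by split.
  by rewrite xV h.
exists V => x; split=> [xV|[]//]; split=> // U maxU.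
have [sVU|nsVU] := boolP (V <= U)%VS; first exact: (subvP sVU).
by case: noU; exists U.
Qed.

(* The intersection of all maximal left ideals of A. *)
Definition jacobson A : {vspace aT} := projT1 (cid (jacobson_exists A)).

Lemma jacobsonP A (x : aT) :
  x \in jacobson A <-> x \in A /\ forall U, maximal_left_ideal A U -> x \in U.
Proof. by rewrite /jacobson; case: cid. Qed.

Definition loewy_length A : nat :=
  least (fun k => (0 < k)%N && (jacobson A ^+ k == 0)%VS).

End Radical.

Section Descent.
Variable gT : finGroupType.
Implicit Types (S I : {set gT}).

Definition x_elt S I : group_algebra rat gT :=
  \sum_(w in X_set S I) galg_of rat w.

Definition descent_algebra S : {vspace group_algebra rat gT} :=
  (\sum_(I in powerset S) <[x_elt S I]>)%VS.

End Descent.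

(* Main.v *)
From HB Require Import structures.
Require Import Defs.
From mathcomp Require Import all_boot all_order all_algebra all_fingroup all_field.
From mathcomp Require Import ring lra zify.

(** Let [W] act on the space [V] spanned by its simple roots. The sign of
  [w (al i)] tells whether [s_i] is a descent of [w] ([len_asc]), and [X_I]
  parametrizes the orbit of the weight [lam I], the sum of the fundamental weights
  outside [I]. Counting orbit points gives Solomon's product formula ([xs_mul]):
  [x_I x_J] is the sum of [x_K], with [K] the set of [j] in [J] whose root is
  orthogonal to [p], over the points [p] of the orbit of [lam I] that are dominant
  for [J]. In particular [x_I x_J] is a multiple of [x_J] modulo smaller sets. The
  multiples define characters [chi J] of the descent algebra, with [chi J x_I]
  the number of orbit points of [lam I] fixed by the parabolic subgroup of [J],
  and the radical is the common kernel of the [chi J] ([jacobsonE]): an element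
  of that kernel lowers by one the filtration [Fil] by the cardinality of [K].

  Upper bound for [n] even. Then [-1] belongs to [W]. Multiplication by this
  central element acts by the sign [(-1)^k] on the layer of the sets with [k]
  elements ([Z_xs], [Z_Fil]), so radical elements, commuting with it, cannot lower
  the filtration by just one: they lower it by two ([in_rad_Fil2]). Moreover the
  radical has no component on the sets with at least [n - 1] elements
  ([in_rad_Fil_pred]). Hence a product of [n / 2] radical elements vanishes
  ([jacobson_exp_uphalf]).

  Lower bound. Put [N = n - 1]. In type D the group acts on [V], which has dimension
  [n], by even signed permutations, and row vectors form a right module over the
  group algebra. Let [eta] be the basis element attached to the orbit of the
  vectors [± e_k], and [xplus] the one attached to the orbit of the half-spin
  weight with coordinates [1/2]. Identify row vectors with polynomials of degree
  at most [N]. The truncations [y_m] of [X^(N - m) (X - 1)^m] are eigenvectors of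
  [eta] for the eigenvalue [2 (N - m)] ([yv_eta]), and for [m] odd [xplus] sends
  [y_m] to a combination of the [y_(m + i)] in which [y_(m + 2)] occurs
  ([yv_plus]). Cutting [xplus] by polynomials in [eta] gives [step m], which moves
  [y_m] to [y_(m + 2)] ([yv_step]). It lies in the radical because a character
  gives a single value to [eta] while [step m] relates two different eigenvalues
  ([step_in_rad]). The chain [y_1, y_3, ...] has [n / 2 - 1] steps for [n] even,
  which proves that the corresponding power of the radical is nonzero
  ([jacobson_neq0_even]).

  For [n] odd the chain reaches [y_(N - 1)]. The two half-spin weights have
  opposite orbits, so their basis elements have the same characters, and their
  difference [h] is in the radical ([h_in_rad]). Neither [y_(N - 1) h] nor
  [y_(N - 1) h h] is zero ([yv_h], [last_row_h]), which provides two further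
  factors ([jacobson_neq0_odd]). *)

Set Implicit Arguments.
Unset Strict Implicit.
Unset Printing Implicit Defensive.

Import Order.TTheory GRing.Theory Num.Theory.

Local Open Scope ring_scope.

(** * Radicals of finite-dimensional algebras *)

Section JacobsonRadical.
Variables (K : fieldType) (aT : falgType K) (A : {vspace aT}).
Hypotheses (A1 : 1 \in A) (AM : (A * A <= A)%VS).

Let memAM a b : a \in A -> b \in A -> a * b \in A.
Proof. by move=> aA bA; apply: (subvP AM); apply: memv_mul. Qed.

(** The kernel of a character is a left ideal of codimension one, hence a maximal
  left ideal. *)
Lemma jacobson_char (chi : {scalar aT}) (x : aT) :
  chi 1 = 1 -> {in A &, {morph chi : a b / a * b}} -> x \in jacobson A -> chi x = 0.
Proof.
move=> chi1 chiM /jacobsonP[xA]; pose f := linfun (chi : aT -> K^o).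
have fE a : f a = chi a by rewrite lfunE.
have kerE a : (a \in A :&: lker f)%VS = (a \in A) && (chi a == 0).
  by rewrite memv_cap memv_ker fE.
have maxU : maximal_left_ideal A (A :&: lker f)%VS.
  split; first split; first exact: capvSl.
  - apply/prodvP=> a b aA; rewrite !kerE => /andP[bA /eqP b0].
    by rewrite memAM // chiM // b0 mulr0 eqxx.
  - by move=> eqA; move: A1; rewrite -{1}eqA kerE chi1 oner_eq0 andbF.
  move=> V [sVA sAV] sUV; have [sVU|/subvPn[v vV]] := boolP (V <= A :&: lker f)%VS.
    by left; apply/eqP; rewrite eqEsubv sVU.
  have vA := subvP sVA v vV; rewrite kerE vA /= => chiv; right.
  apply/eqP; rewrite eqEsubv sVA; apply/subvP=> a aA.
  rewrite -[a](subrK ((chi a / chi v) *: v)) rpredD ?rpredZ //.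
  apply: (subvP sUV); rewrite kerE rpredB ?rpredZ //=.
  by rewrite linearB linearZ /= divfK // subrr.
by move=> /(_ _ maxU); rewrite kerE => /andP[_ /eqP].
Qed.

(** If a maximal left ideal [U] missed [x], then [1 = u + a * x] for some [u] in
  [U]; but [1 - a * x] is inverted by a finite geometric series. *)
Lemma jacobson_nil (x : aT) :
  x \in A -> (forall a, a \in A -> exists k, (a * x) ^+ k = 0) -> x \in jacobson A.
Proof.
move=> xA nil_x; apply/jacobsonP; split=> // U [[sUA sAU] neqUA maxU].
apply/negPn/negP=> nUx; pose V := (U + (amulr x @: A))%VS.
have xV : x \in V.
  by rewrite -[x]add0r memv_add ?mem0v //; apply/memv_imgP; exists 1; rewrite ?lfunE /= ?mul1r.
have [||VU|VA] := maxU V; last 2 first.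
- by case/negP: nUx; rewrite -VU.
- move: A1; rewrite -VA => /memv_addP[u uU [y /memv_imgP[a aA ->]]].
  rewrite lfunE /= => def1; have [k ax0] := nil_x a aA.
  have def_u : u = 1 - a * x by rewrite def1 addrK.
  have U1 : 1 \in U.
    have -> : 1 = (\sum_(i < k) (a * x) ^+ i) * u.
      have := subrX1 (a * x) k; rewrite ax0 sub0r def_u => e.
      have comm : GRing.comm (a * x - 1) (\sum_(i < k) (a * x) ^+ i).
        apply: commr_sum => i _; apply: commrX; apply/commr_sym.
        by apply: commrB; [exact: commr_refl | exact: commr1].
      by rewrite -opprB mulrN -comm -e opprK.
    apply: (subvP sAU); apply: memv_mul uU; apply: memv_suml => i _.
    elim: (i : nat) => [|j IHj]; first by rewrite expr0.
    by rewrite exprS !memAM.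
  case: neqUA; apply/eqP; rewrite eqEsubv sUA; apply/subvP=> b bA.
  by rewrite -[b]mulr1; apply: (subvP sAU); apply: memv_mul.
- split; first rewrite subv_add sUA; first apply/subvP=> _ /memv_imgP[a aA ->].
    by rewrite lfunE /= memAM.
  apply/prodvP=> a _ aA /memv_addP[u uU [_ /memv_imgP[b bA ->] ->]].
  rewrite mulrDr memv_add //; first by apply: (subvP sAU); apply: memv_mul.
  by apply/memv_imgP; exists (a * b); rewrite ?memAM // !lfunE /= mulrA.
exact: addvSl.
Qed.

Lemma memv_prod_expv (U : {vspace aT}) k (r : 'I_k -> aT) :
  (forall i, r i \in U) -> \prod_i r i \in (U ^+ k)%VS.
Proof.
elim: k r => [|k IHk] r rU; first by rewrite big_ord0 expv0 memv_line.
by rewrite big_ord_recl expvSl memv_mul ?IHk.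
Qed.

Lemma loewy_length_least k : (0 < k)%N -> (jacobson A ^+ k == 0)%VS ->
  [/\ (0 < loewy_length A)%N, (jacobson A ^+ loewy_length A == 0)%VS
    & (loewy_length A <= k)%N].
Proof.
move=> k0 Jk; have [] := @leastP (fun k => (0 < k)%N && (jacobson A ^+ k == 0)%VS).
  by exists k; rewrite k0.
by move=> /andP[? ?] /(_ k); rewrite k0 => /(_ Jk).
Qed.

Lemma loewy_length_lt k m : (0 < k)%N -> (jacobson A ^+ k == 0)%VS ->
  (jacobson A ^+ m != 0)%VS -> (m < loewy_length A)%N.
Proof.
move=> k0 Jk Jm; have [_ JL _] := loewy_length_least k0 Jk.
rewrite ltnNge; apply: contra Jm => le_Lm.
by rewrite -(subnK le_Lm) expvD (eqP JL) prodv0.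
Qed.

End JacobsonRadical.

(** * Lengths of words *)

Section Length.
Variables (gT : finGroupType) (S : {set gT}).
Hypothesis genS : <<S>>%g = [set: gT].
Variable sgn : gT -> bool.
Hypothesis sgnM : {morph sgn : x y / (x * y)%g >-> x (+) y}.
Hypothesis sgnS : {in S, forall s, sgn s}.
Hypothesis invS : {in S, forall s, (s * s)%g = 1%g}.
Local Notation len := (cox_length S).
Implicit Types w s : gT.

Lemma mem_expg_prod k (c : 'I_k -> gT) :
  (forall i, c i \in S) -> (\prod_i c i)%g \in (S ^+ k)%g.
Proof.
elim: k c => [|k IHk] c Sc; first by rewrite big_ord0 set11.
by rewrite big_ord_recl expgS mem_mulg // IHk.
Qed.

Lemma lenP w : w \in (S ^+ len w)%g /\ forall k, w \in (S ^+ k)%g -> (len w <= k)%N.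
Proof.
apply: leastP.
have : w \in <<S>>%g by rewrite genS inE.
by case/gen_prodgP=> k [c Sc ->]; exists k; apply: mem_expg_prod.
Qed.

Lemma sgn_expg k w : w \in (S ^+ k)%g -> sgn w = odd k.
Proof.
have sgn1 : sgn 1%g = false.
  by have := sgnM 1%g 1%g; rewrite mulg1; case: (sgn _).
elim: k w => [|k IHk] w; first by rewrite expg0 => /set1P->.
by rewrite expgS => /mulsgP[x y xS yS ->]; rewrite sgnM sgnS // (IHk y).
Qed.

Lemma odd_len w : odd (len w) = sgn w.
Proof. by rewrite (@sgn_expg (len w)) //; case: (lenP w). Qed.

Lemma len_mulS w s : s \in S -> (len (w * s) <= (len w).+1)%N.
Proof.
move=> sS; case: (lenP (w * s)%g) => _; apply.
by rewrite expgSr mem_mulg //; case: (lenP w).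
Qed.

(** Multiplication by a generator changes the parity of the length. *)
Lemma len_mulS_cases w s : s \in S ->
  len (w * s) = (len w).+1 \/ len w = (len (w * s)).+1.
Proof.
move=> sS; have := len_mulS w sS; have := len_mulS (w * s)%g sS.
rewrite -mulgA invS // mulg1 => h1 h2.
have : odd (len (w * s)) = ~~ odd (len w) by rewrite !odd_len sgnM (sgnS sS) addbT.
by lia.
Qed.

Lemma len0P w : len w = 0%N -> w = 1%g.
Proof. by move=> e; case: (lenP w); rewrite e expg0 => /set1P. Qed.

Lemma lenS_ex w k : len w = k.+1 ->
  exists2 w', len w' = k & exists2 s, s \in S & w = (w' * s)%g.
Proof.
move=> e; case: (lenP w); rewrite e expgSr => /mulsgP[w' s w'S sS def_w] _.
exists w'; last by exists s.
have [_ /(_ _ w'S) le_k] := lenP w'.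
by have := len_mulS w' sS; rewrite -def_w e; lia.
Qed.

End Length.

(** * Reflection representations *)

Definition dot n (u v : 'cV[rat]_n) : rat := (u^T *m v) 0 0.

Section Dot.
Variable n : nat.
Implicit Types u v w : 'cV[rat]_n.

Lemma dotE u v : dot u v = \sum_k u k 0 * v k 0.
Proof. by rewrite /dot mxE; apply: eq_bigr => k _; rewrite mxE. Qed.

Lemma dotC u v : dot u v = dot v u.
Proof. by rewrite !dotE; apply: eq_bigr => k _; rewrite mulrC. Qed.

Lemma dotDr u v w : dot u (v + w) = dot u v + dot u w.
Proof. by rewrite /dot mulmxDr mxE. Qed.

Lemma dotNr u v : dot u (- v) = - dot u v.
Proof. by rewrite /dot mulmxN mxE. Qed.

Lemma dotZr a u v : dot u (a *: v) = a * dot u v.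
Proof. by rewrite /dot -scalemxAr mxE. Qed.

Lemma dot_sumr u (I : finType) (P : pred I) (F : I -> 'cV[rat]_n) :
  dot u (\sum_(i | P i) F i) = \sum_(i | P i) dot u (F i).
Proof. by rewrite /dot mulmx_sumr summxE. Qed.

Lemma dotDl u v w : dot (v + w) u = dot v u + dot w u.
Proof. by rewrite dotC dotDr !(dotC u). Qed.

Lemma dotNl u v : dot (- v) u = - dot v u.
Proof. by rewrite dotC dotNr dotC. Qed.

Lemma dotZl a u v : dot (a *: v) u = a * dot v u.
Proof. by rewrite dotC dotZr dotC. Qed.

Lemma dot_suml u (I : finType) (P : pred I) (F : I -> 'cV[rat]_n) :
  dot (\sum_(i | P i) F i) u = \sum_(i | P i) dot (F i) u.
Proof. by rewrite dotC dot_sumr; apply: eq_bigr => i _; rewrite dotC. Qed.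

End Dot.

Definition reflmx n (a : 'cV[rat]_n) : 'M[rat]_n := 1%:M - a *m a^T.

Lemma reflmxE n (a v : 'cV[rat]_n) : reflmx a *m v = v - dot a v *: a.
Proof.
rewrite mulmxBl mul1mx -mulmxA [a^T *m v]mx11_scalar.
by rewrite scalar_mxC mul_scalar_mx.
Qed.

Lemma eq_mulmx_cV m n (A B : 'M[rat]_(m, n)) :
  (forall v : 'cV_n, A *m v = B *m v) -> A = B.
Proof.
by move=> eqAB; apply/matrixP=> i j; have /colP/(_ i) := eqAB (delta_mx j 0); rewrite -!colE !mxE.
Qed.

Lemma reflmx_invol n (a : 'cV[rat]_n) : dot a a = 2 -> reflmx a *m reflmx a = 1%:M.
Proof.
move=> a2; apply: eq_mulmx_cV => v; rewrite -mulmxA !reflmxE mul1mx.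
rewrite dotDr dotNr dotZr a2; apply/colP=> k; rewrite !mxE; ring.
Qed.

Lemma reflmx_comm n (a b : 'cV[rat]_n) : dot a b = 0 ->
  reflmx a *m reflmx b = reflmx b *m reflmx a.
Proof.
move=> ab; apply: eq_mulmx_cV => v; rewrite -!mulmxA !reflmxE.
rewrite !(dotDr, dotNr, dotZr) [dot b a]dotC ab.
by apply/colP=> k; rewrite !mxE; ring.
Qed.

Lemma reflmx_braid n (a b : 'cV[rat]_n) :
  dot a a = 2 -> dot b b = 2 -> dot a b = -1 ->
  reflmx a *m reflmx b *m reflmx a = reflmx b *m reflmx a *m reflmx b.
Proof.
move=> a2 b2 ab; apply: eq_mulmx_cV => v; rewrite -!mulmxA !reflmxE.
rewrite !(dotDr, dotNr, dotZr) [dot b a]dotC ab a2 b2.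
by apply/colP=> k; rewrite !mxE; ring.
Qed.

(** A simply laced Coxeter group with its reflection representation. The simple
  roots [al] are normalized so that they coincide with their coroots, and [om]
  is the basis of fundamental weights. The parity [rr_sgn] is that of the length. *)
Record reflection_rep (gT : finGroupType) n (s : 'I_n -> gT)
    (M : gT -> 'M[rat]_n) (al om : 'I_n -> 'cV[rat]_n) : Prop := ReflectionRep {
  rr_gen : <<[set s i | i : 'I_n]>>%g = [set: gT];
  rr_inv : forall i, (s i * s i)%g = 1%g;
  rr_sgn : exists2 sgn : gT -> bool,
    {morph sgn : x y / (x * y)%g >-> x (+) y} & forall i, sgn (s i);
  rr_M : {morph M : x y / (x * y)%g >-> x *m y};
  rr_refl : forall i, M (s i) = reflmx (al i);
  rr_norm : forall i, dot (al i) (al i) = 2;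
  rr_braid : forall i j, i != j ->
    dot (al i) (al j) = 0 /\ (s i * s j = s j * s i)%g \/
    dot (al i) (al j) = -1 /\ (s i * s j * s i = s j * s i * s j)%g;
  rr_dual : forall i j, dot (om i) (al j) = (i == j)%:R }.

Lemma sum_subset_sign (R : comNzRingType) (T : finType) (A : {set T}) :
  \sum_(D : {set T} | D \subset A) (-1) ^+ #|D| = (A == set0)%:R :> R.
Proof.
transitivity (\prod_(i : T) (- (i \in A)%:R + 1) : R).
  rewrite bigA_distr big_mkcond /=; apply: eq_bigr => D _; rewrite -big_mkcond /=.
  case: ifPn => [sDA|/subsetPn[i iD niA]]; last first.
    by rewrite (bigD1 i) //= (negPf niA) oppr0 mul0r.
  by rewrite -prodr_const; apply: eq_bigr => i iD; rewrite (subsetP sDA).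
have [->|[i iA]] := set_0Vmem A.
  by rewrite eqxx big1 // => i _; rewrite inE oppr0 add0r.
rewrite (bigD1 i) //= iA addNr mul0r; case: eqP => // A0.
by rewrite A0 inE in iA.
Qed.

Section ReflectionGroup.
Variables (gT : finGroupType) (n : nat) (s : 'I_n -> gT) (M : gT -> 'M[rat]_n).
Variables (al om : 'I_n -> 'cV[rat]_n).
Hypothesis rr : reflection_rep s M al om.
Local Notation S := [set s i | i : 'I_n].
Local Notation len := (cox_length S).
Local Notation A := (descent_algebra S).
Implicit Types (w g h x y : gT) (u v l : 'cV[rat]_n) (I J K D : {set 'I_n}).
Implicit Types (a b : group_algebra rat gT).

Let MM := rr_M rr.

(** [pos v] means that [v] is a nonzero nonnegative combination of simple roots;
  the cone is described by its dual so that no coefficients are needed. By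
  [len_asc] below, [asc w i] is the condition that [s i] lengthens [w], read off
  from the sign of the root [w (al i)]. *)
Definition dominant v := [forall i, 0 <= dot v (al i)].
Definition rho : 'cV[rat]_n := \sum_i om i.
Definition asc w i := 0 < dot rho (M w *m al i).
Definition pos v := (forall l, dominant l -> 0 <= dot l v) /\ 0 < dot rho v.

Let sS i : s i \in S. Proof. by apply/imsetP; exists i. Qed.
Let genS := rr_gen rr.
Let invS : {in S, forall t, (t * t)%g = 1%g}.
Proof. by move=> _ /imsetP[i _ ->]; apply: rr_inv rr i. Qed.

Let len_cases w i : len (w * s i) = (len w).+1 \/ len w = (len (w * s i)).+1.
Proof.
have [sgn sM s1] := rr_sgn rr.
apply: (len_mulS_cases genS sM _ invS) => //.
by move=> _ /imsetP[j _ ->].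
Qed.

Let len_le w i : (len (w * s i) <= (len w).+1)%N.
Proof. by apply: len_mulS (sS i); apply: genS. Qed.

Lemma rep_refl i v : M (s i) *m v = v - dot (al i) v *: al i.
Proof. by rewrite (rr_refl rr) reflmxE. Qed.

Lemma rep1 : M 1%g = 1%:M.
Proof.
have [n0|/card_gt0P[i _]] := posnP #|'I_n|.
  by apply/matrixP=> i; have := ltn_ord i; rewrite -{2}(card_ord n) n0.
by rewrite -(rr_inv rr i) MM (rr_refl rr) reflmx_invol ?(rr_norm rr).
Qed.

Lemma repV w v : M w *m (M w^-1%g *m v) = v.
Proof. by rewrite mulmxA -MM mulgV rep1 mul1mx. Qed.

Lemma repVK w v : M w^-1%g *m (M w *m v) = v.
Proof. by rewrite mulmxA -MM mulVg rep1 mul1mx. Qed.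

Lemma gen_cox_ind (P : gT -> Prop) :
  P 1%g -> (forall w i, P w -> P (w * s i)%g) -> forall w, P w.
Proof.
move=> P1 PM w; have [k] := ubnP (len w); elim: k w => // k IHk w.
case e: (len w) => [|m] lt_mk; first by rewrite (len0P genS e).
have [w' lw' [_ /imsetP[i _ ->] ->]] := lenS_ex genS e.
by apply/PM/IHk; rewrite lw'.
Qed.

Lemma dot_rep w u v : dot (M w *m u) (M w *m v) = dot u v.
Proof.
elim/gen_cox_ind: w u v => [|w i IHw] u v; first by rewrite rep1 !mul1mx.
rewrite MM -!mulmxA IHw !rep_refl !(dotDl, dotDr, dotNl, dotNr, dotZl, dotZr).
rewrite (rr_norm rr) [dot u (al i)]dotC; ring.
Qed.

Lemma dot_repl w u v : dot (M w *m u) v = dot u (M w^-1%g *m v).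
Proof. by rewrite -[RHS](dot_rep w) repV. Qed.

Lemma dot_rho i : dot rho (al i) = 1.
Proof.
rewrite dot_suml (bigD1 i) //= (rr_dual rr) eqxx big1 ?addr0 // => j /negPf ji.
by rewrite (rr_dual rr) ji.
Qed.

Lemma posD u v : pos u -> pos v -> pos (u + v).
Proof.
move=> [u1 u2] [v1 v2]; split=> [l dl|]; last by rewrite dotDr addr_gt0.
by rewrite dotDr addr_ge0 ?u1 ?v1.
Qed.

Lemma pos_al i : pos (al i).
Proof. by split=> [l /forallP/(_ i)//|]; rewrite dot_rho. Qed.

(** Induction on the length. Write [w = w1 s_j] with [w1] shorter. The braid
  relation between [s_i] and [s_j] expresses [w (al i)] as [w1 (al i)], as
  [w1 (al i) + w1 (al j)], or as [w2 (al j)] with [w2 = w1 s_i] shorter still.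
  An ascent needed there of a shorter element is present, since its absence
  would let the braid relation shorten [w s_i]. *)
Lemma len_lt_pos w i : (len w < len (w * s i))%N -> pos (M w *m al i).
Proof.
have [k] := ubnP (len w); elim: k w i => // k IHk w i.
case e: (len w) => [|m] lt_mk lt_w.
  by rewrite (len0P genS e) rep1 mul1mx; apply: pos_al.
have [w1 lw1 [_ /imsetP[j _ ->] def_w]] := lenS_ex genS e.
have w_sj : (w * s j)%g = w1 by rewrite def_w -mulgA (rr_inv rr) mulg1.
have ij : i != j by apply: contraTneq lt_w => ->; rewrite w_sj lw1 -leqNgt ltnW.
have pos_j : pos (M w1 *m al j) by apply: IHk; rewrite ?lw1 // -def_w e.
have [[d0 com]|[d1 braid]] := rr_braid rr ij.
  have -> : M w *m al i = M w1 *m al i.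
    by rewrite def_w MM -mulmxA rep_refl dotC d0 scale0r subr0.
  apply: IHk; rewrite lw1 //.
  have [->|e2] := len_cases w1 i; first by rewrite lw1.
  have := len_le (w1 * s i)%g j; rewrite -mulgA com mulgA -def_w.
  by move/(leq_trans lt_w); rewrite ltnS -lw1 e2 ltnNge leqnSn.
have -> : M w *m al i = M w1 *m al i + M w1 *m al j.
  by rewrite def_w MM -mulmxA rep_refl dotC d1 scaleN1r opprK mulmxDr.
have [e2|e2] := len_cases w1 i; first by apply: posD => //; apply: IHk; rewrite ?e2 lw1.
set w2 := (w1 * s i)%g in e2.
have def_w1 : w1 = (w2 * s i)%g by rewrite -mulgA (rr_inv rr) mulg1.
clearbody w2.
have -> : M w1 *m al i + M w1 *m al j = M w2 *m al j.
  rewrite -mulmxDr def_w1 MM -mulmxA mulmxDr !rep_refl (rr_norm rr) d1; congr (_ *m _).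
  by apply/colP=> r; rewrite !mxE; ring.
apply: IHk; first by rewrite -ltnS -e2 lw1 ltnW.
have [->|e3] := len_cases w2 j; first exact: ltnSn.
have := len_le (w2 * s j * s i)%g j.
have -> : (w2 * s j * s i * s j)%g = (w * s i)%g.
  by rewrite def_w def_w1 -!mulgA; congr (_ * _)%g; rewrite !mulgA -braid.
by have := len_le (w2 * s j)%g i; move: lt_w; lia.
Qed.

Lemma len_gt_pos w i : ~~ (len w < len (w * s i))%N -> pos (- (M w *m al i)).
Proof.
move=> nlt; have -> : - (M w *m al i) = M (w * s i)%g *m al i.
  rewrite MM -mulmxA rep_refl (rr_norm rr) -mulmxN; congr (_ *m _).
  by apply/colP=> r; rewrite !mxE; ring.
apply: len_lt_pos; rewrite -mulgA (rr_inv rr) mulg1.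
by case: (len_cases w i) nlt; lia.
Qed.

Lemma pos_gt0 v : pos v -> 0 < dot rho v. Proof. by case. Qed.

Lemma pos_asym v : pos v -> pos (- v) -> False.
Proof.
by move=> /pos_gt0 h1 /pos_gt0; rewrite dotNr oppr_gt0 => /(lt_trans h1); rewrite ltxx.
Qed.

Lemma len_asc w i : (len w < len (w * s i))%N = asc w i.
Proof.
apply/idP/idP=> [/len_lt_pos/pos_gt0//|]; apply: contraTT => /len_gt_pos/pos_gt0.
by rewrite /asc dotNr oppr_gt0 -leNgt => /ltW.
Qed.

Lemma ascP w i : asc w i -> pos (M w *m al i).
Proof. by rewrite -len_asc; apply: len_lt_pos. Qed.

Lemma ascN w i : ~~ asc w i -> pos (- (M w *m al i)).
Proof. by rewrite -len_asc; apply: len_gt_pos. Qed.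

(** The length of a nontrivial element is lowered by the last letter of a reduced
  word; faithfulness follows in [rep_inj]. *)
Lemma asc_all w : (forall i, asc w i) -> w = 1%g.
Proof.
move=> asc_w; case e: (len w) => [|m]; first by rewrite (len0P genS e).
have [w1 lw1 [_ /imsetP[j _ ->] def_w]] := lenS_ex genS e.
have := asc_w j; rewrite -len_asc def_w -mulgA (rr_inv rr) mulg1 lw1 -def_w e.
by rewrite ltnNge leqnSn.
Qed.

Lemma rep_inj w w' : M w = M w' -> w = w'.
Proof.
move=> eqM; apply: (mulgI w'^-1%g); rewrite mulVg; apply: asc_all => i.
by rewrite /asc MM eqM -MM mulVg rep1 mul1mx dot_rho.
Qed.

Lemma dual_basis v : v = \sum_i dot (om i) v *: al i.
Proof.
pose A := \matrix_(i, j) al i j 0; pose O := \matrix_(i, j) om i j 0.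
have /mulmx1C AO : O *m A^T = 1%:M.
  apply/matrixP=> i j; rewrite !mxE -(rr_dual rr) dotE.
  by apply: eq_bigr => k _; rewrite !mxE.
rewrite -{1}[v]mul1mx -AO -mulmxA; apply/colP=> k; rewrite mxE summxE.
apply: eq_bigr => i _; rewrite !mxE dotE mulrC; congr (_ * _).
by apply: eq_bigr => j _; rewrite !mxE.
Qed.

Lemma dot_eq0 v : dot v v <= 0 -> v = 0.
Proof.
rewrite dotE => h; have sq_ge0 k : 0 <= v k 0 * v k 0 by rewrite -expr2 sqr_ge0.
have /eqP : \sum_k v k 0 * v k 0 = 0 by apply/eqP; rewrite eq_le h sumr_ge0.
rewrite psumr_eq0 // => /allP v0; apply/colP=> k; rewrite mxE.
by have /= := v0 k (mem_index_enum _); rewrite mulf_eq0 orbb => /eqP.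
Qed.

(** Along a reduced word for [w], each reflection subtracts from the image of [u]
  a nonnegative multiple of a positive vector. *)
Lemma dot_rep_le w u l : dominant u -> dominant l -> dot l (M w *m u) <= dot l u.
Proof.
move=> du dl; have [k] := ubnP (cox_length [set s i | i : 'I_n] w).
elim: k w => // k IHk w; case e: (cox_length _ w) => [|m] lt_mk.
  by rewrite (len0P (rr_gen rr) e) rep1 mul1mx.
have [w1 lw1 [_ /imsetP[i _ ->] def_w]] := lenS_ex (rr_gen rr) e.
have lt_w1 : (cox_length [set s i | i : 'I_n] w1 < k)%N by rewrite lw1.
apply: le_trans (IHk w1 lt_w1); rewrite def_w (rr_M rr) -mulmxA rep_refl.
rewrite mulmxBr dotDr dotNr -scalemxAr dotZr gerBl mulr_ge0 //.
  by rewrite dotC; have /forallP := du.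
have : asc w1 i by rewrite -len_asc lw1 -def_w e.
by case/ascP=> h _; apply: h.
Qed.

(** By [dot_rep_le] the squared norm of [M g *m u - u] is at most 0. *)
Lemma dominant_orbit g u : dominant u -> dominant (M g *m u) -> M g *m u = u.
Proof.
move=> du dgu; apply/eqP; rewrite -subr_eq0; apply/eqP/dot_eq0.
have := dot_rep_le g du dgu; rewrite dot_rep.
rewrite !(dotDl, dotDr, dotNl, dotNr) dot_rep (dotC u (M g *m u)); lra.
Qed.

(** * Descent classes and the Mackey formula *)

Definition lam I : 'cV[rat]_n := \sum_(i | i \notin I) om i.

(** The stabilizer of [lam I] is the parabolic subgroup generated by the [s i],
  [i] in [I], and [Xs I] is the set of minimal representatives of its left
  cosets. Cosets are handled as points of the orbit of [lam I], a point
  determining its representative by [Xs_inj]. *)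
Definition Xs I : {set gT} := [set w | [forall i in I, asc w i]].
Definition xs I : group_algebra rat gT := \sum_(w in Xs I) galg_of rat w.

Lemma XsP I w : reflect {in I, forall i, asc w i} (w \in Xs I).
Proof. by rewrite inE; apply: forall_inP. Qed.

Lemma X_setE I : X_set S (s @: I) = Xs I.
Proof.
apply/setP=> w; rewrite !inE; apply/forall_inP/forall_inP=> [h i iI|h _ /imsetP[i iI ->]].
  by rewrite -len_asc h // imset_f.
by rewrite len_asc h.
Qed.

Lemma x_eltE I : x_elt S (s @: I) = xs I.
Proof. by rewrite /x_elt X_setE. Qed.

Lemma descent_algebraE : descent_algebra S = (\sum_I <[xs I]>)%VS.
Proof.
apply/eqP; rewrite eqEsubv; apply/andP; split; apply/subv_sumP=> I.
  rewrite inE => sIS; have -> : I = s @: (s @^-1: I).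
    apply/setP=> t; apply/idP/imsetP=> [tI|[i]]; last by rewrite inE => iI ->.
    by have /imsetP[i _ def_t] := subsetP sIS t tI; exists i; rewrite // inE -def_t.
  by rewrite x_eltE; apply: (sumv_sup (s @^-1: I)).
move=> _; apply: (sumv_sup (s @: I)); last by rewrite x_eltE.
by rewrite inE; apply: imsetS; apply/subsetP.
Qed.

Lemma xsE I g : xs I g = (g \in Xs I)%:R.
Proof.
rewrite sum_ffunE; case: (boolP (g \in Xs I)) => [Xg|nXg].
  rewrite (bigD1 g) //= ffunE eqxx big1 ?addr0 // => h /andP[_ /negPf hg].
  by rewrite ffunE eq_sym hg.
by rewrite big1 // => h Xh; rewrite ffunE; case: eqP => // gh; rewrite gh Xh in nXg.
Qed.

Lemma xs_mulE I J w : (xs I * xs J) w = (#|[set h in Xs I | (h^-1 * w)%g \in Xs J]|)%:R.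
Proof.
rewrite ffunE -sum1_card natr_sum [RHS]big_mkcond /=; apply: eq_bigr => h _.
rewrite !xsE; move: (Xs I) (Xs J) => X Y; rewrite inE.
by case: (h \in X); case: (_ \in Y); rewrite ?mul0r ?mulr0 ?mulr1.
Qed.

Lemma dot_lam I j : dot (lam I) (al j) = (j \notin I)%:R.
Proof.
rewrite dot_suml; under eq_bigr do rewrite (rr_dual rr).
have [jI|njI] := boolP (j \in I).
  by rewrite big1 // => i niI; case: eqP => // ij; rewrite ij jI in niI.
by rewrite (bigD1 j) //= eqxx big1 ?addr0 // => i /andP[_ /negPf->].
Qed.

Lemma dominant_lam I : dominant (lam I).
Proof. by apply/forallP=> i; rewrite dot_lam ler0n. Qed.

Lemma dominant_om i : dominant (om i).
Proof. by apply/forallP=> j; rewrite (rr_dual rr) ler0n. Qed.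

(** The orthogonality to [lam I] makes [v] a combination of the [al i], [i] in
  [I], and [w] sends these roots to positive vectors. *)
Lemma pos_rep I w v : w \in Xs I -> pos v -> dot (lam I) v = 0 -> pos (M w *m v).
Proof.
move=> Xw [v_ge0 v_gt0] lam_v.
have c_ge0 i : 0 <= dot (om i) v by apply: v_ge0; apply: dominant_om.
have c0 i : i \notin I -> dot (om i) v = 0.
  move=> niI; apply/eqP; rewrite eq_le c_ge0 andbT -lam_v dot_suml (bigD1 i) //=.
  by rewrite lerDl sumr_ge0.
have dM l : dot l (M w *m v) = \sum_(i in I) dot (om i) v * dot l (M w *m al i).
  rewrite {1}(dual_basis v) mulmx_sumr dot_sumr [RHS]big_mkcond; apply: eq_bigr => i _.
  rewrite -scalemxAr dotZr; case: ifPn => // /c0->; exact: mul0r.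
split=> [l dl|].
  rewrite dM sumr_ge0 // => i iI; rewrite mulr_ge0 //.
  by have /XsP/(_ i iI)/ascP[h _] := Xw; apply: h.
rewrite dM; have /existsP[i ci] : [exists i, 0 < dot (om i) v].
  apply: contraTT v_gt0; rewrite negb_exists -leNgt => /forallP c_le0.
  rewrite dot_suml big1 // => i _; apply/eqP; rewrite eq_le c_ge0 andbT.
  by rewrite leNgt.
have iI : i \in I by apply: contraTT ci => /c0->; rewrite ltxx.
rewrite (bigD1 i) //= ltr_wpDr ?mulr_gt0 //; last by have /XsP/(_ i iI) := Xw.
rewrite sumr_ge0 // => j /andP[jI _]; rewrite mulr_ge0 //.
by apply/ltW; have /XsP/(_ j jI) := Xw.
Qed.

Lemma Xs_inj I g h : g \in Xs I -> h \in Xs I -> M g *m lam I = M h *m lam I -> g = h.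
Proof.
move=> Xg Xh eq_gh; apply: (mulgI h^-1%g); rewrite mulVg; apply: asc_all => i.
apply/negPn/negP=> /ascN; set w := (_ * _)%g => posN.
have w_lam : M w *m lam I = lam I by rewrite MM -mulmxA eq_gh repVK.
have d_al : dot (lam I) (- (M w *m al i)) = - dot (lam I) (al i).
  by rewrite dotNr -{1}w_lam dot_rep.
have iI : i \in I.
  have := posN.1 _ (dominant_lam I); rewrite d_al oppr_ge0 dot_lam.
  by case: (i \in I) => //=; rewrite ler10.
have d0 : dot (lam I) (- (M w *m al i)) = 0 by rewrite d_al dot_lam iI oppr0.
have := pos_rep Xh posN d0; rewrite mulmxN MM -mulmxA repV.
by move/(pos_asym (ascP (XsP _ _ Xg i iI))).
Qed.

Definition coset_rep I g := [arg min_(h < g | M h *m lam I == M g *m lam I) len h].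

(** A shortest element of the coset has no descent in [I]: multiplication by [s i]
  stays in the coset. *)
Lemma coset_repP I g :
  coset_rep I g \in Xs I /\ M (coset_rep I g) *m lam I = M g *m lam I.
Proof.
rewrite /coset_rep; case: arg_minnP => [|u /eqP u_lam min_u]; first exact: eqxx.
split=> //; apply/XsP=> i iI; rewrite -len_asc ltnNge; apply/negP=> le_u.
have : (len u <= len (u * s i))%N.
  apply: min_u; rewrite MM -mulmxA rep_refl dotC dot_lam iI scale0r subr0.
  exact/eqP.
move=> ge_u; have := len_asc u i; have : len (u * s i) = len u.
  by apply/eqP; rewrite eqn_leq le_u.
move=> e; rewrite e ltnn => /esym/negbT/ascN.
have := len_asc (u * s i)%g i; rewrite -mulgA (rr_inv rr) mulg1 e ltnn.
move=> /esym/negbT/ascN; rewrite MM -mulmxA rep_refl (rr_norm rr).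
have -> : al i - 2 *: al i = - al i by apply/colP=> r; rewrite !mxE; ring.
rewrite !mulmxN opprK; exact: pos_asym.
Qed.

Lemma coset_rep_id I g h : h \in Xs I -> M h *m lam I = M g *m lam I -> coset_rep I g = h.
Proof. by move=> Xh e; case: (coset_repP I g) => Xr er; apply: (Xs_inj Xr Xh); rewrite er. Qed.

(** The pairing of [lam I] with the root [(h^-1 w) (al j)] decides its sign unless
  it vanishes; then the root lies in the span of the [al i], [i] in [I], where
  [h] preserves signs. *)
Lemma asc_cosetE I h w j : h \in Xs I ->
  asc (h^-1 * w) j =
    (0 < dot (al j) (M (w^-1 * h)%g *m lam I))
      || (dot (al j) (M (w^-1 * h)%g *m lam I) == 0) && asc w j.
Proof.
move=> Xh; set d := dot _ _; pose b := M (h^-1 * w)%g *m al j.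
have dE : d = dot (lam I) b by rewrite /d dotC dot_repl invMg invgK.
have hb : M h *m b = M w *m al j by rewrite mulmxA -MM mulKVg.
have [d_gt0|d_lt0|d0] := ltgtP d 0; rewrite -?dE //=.
- apply: contraTF d_gt0 => /ascP[/(_ _ (dominant_lam I))]; rewrite -dE.
  by rewrite leNgt.
- apply: contraTT d_lt0 => /ascN[/(_ _ (dominant_lam I))]; rewrite dotNr -dE.
  by rewrite oppr_ge0 leNgt.
apply/idP/idP=> [/ascP|].
  by rewrite -/b => /(pos_rep Xh); rewrite -dE hb => /(_ d0)[].
apply: contraLR => /ascN; rewrite -/b => /(pos_rep Xh).
rewrite dotNr -dE d0 oppr0 mulmxN hb => /(_ erefl) posN; apply/negP => /ascP p.
exact: pos_asym p posN.
Qed.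

(** [cdom I J g] says that the orbit point [g (lam I)] is dominant for the
  parabolic subgroup of [J], and [cperp I J g] generates its stabilizer there. *)
Definition cdom I J g := [forall j in J, 0 <= dot (al j) (M g *m lam I)].
Definition cperp I J g := [set j in J | dot (al j) (M g *m lam I) == 0].

Lemma mem_Xs_coset I J h w g : h \in Xs I -> M g *m lam I = M (w^-1 * h)%g *m lam I ->
  ((h^-1 * w)%g \in Xs J) = cdom I J g && (w \in Xs (cperp I J g)).
Proof.
move=> Xh eq_g; apply/XsP/andP=> [asc_J|[/forall_inP dJ /XsP asc_w] j jJ].
  split; first apply/forall_inP=> j /asc_J.
    by rewrite (asc_cosetE _ _ Xh) -eq_g le_eqVlt eq_sym => /orP[->|/andP[->]//]; rewrite orbT.
  apply/XsP=> j; rewrite inE => /andP[/asc_J]; rewrite (asc_cosetE _ _ Xh) -eq_g.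
  by move=> asc_j /eqP d0; move: asc_j; rewrite d0 ltxx eqxx.
rewrite (asc_cosetE _ _ Xh) -eq_g; have := dJ j jJ; rewrite le_eqVlt => /orP[/eqP d0|->//].
by rewrite -d0 ltxx eqxx /= asc_w // inE jJ -d0 eqxx.
Qed.

(** The Mackey formula of Solomon. The pairs [(h, k)] with [h * k = w] are counted
  through the orbit points [w^-1 h (lam I)]: by [mem_Xs_coset] such a point
  contributes exactly when it is [J]-dominant and [w] has no descent in its
  stabilizer. *)
Lemma xs_mul I J : xs I * xs J = \sum_(g in Xs I | cdom I J g) xs (cperp I J g).
Proof.
apply/ffunP=> w; rewrite xs_mulE sum_ffunE.
transitivity ((#|[set g in Xs I | cdom I J g && (w \in Xs (cperp I J g))]|)%:R : rat); last first.
  rewrite -sum1_card natr_sum big_mkcond [RHS]big_mkcond; apply: eq_bigr => g _.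
  by rewrite xsE in_set; case: (g \in _) => //=; case: (cdom _ _ _) => //=; case: (w \in _).
congr (_%:R); rewrite -(@card_in_imset _ _ (fun h => coset_rep I (w^-1 * h)%g)); last first.
  move=> h h'; rewrite in_set => /andP[Xh _]; rewrite in_set => /andP[Xh' _] /= e.
  have [_ e1] := coset_repP I (w^-1 * h)%g; have [_ e2] := coset_repP I (w^-1 * h')%g.
  apply: (Xs_inj Xh Xh'); rewrite -(repV w (M h *m _)) -(repV w (M h' *m _)).
  by congr (_ *m _); rewrite !mulmxA -!MM -e1 -e2 e.
apply: eq_card => g; apply/imsetP/idP=> [[h]|].
  rewrite in_set => /andP[Xh XJ] ->; have [Xr er] := coset_repP I (w^-1 * h)%g.
  by rewrite in_set Xr -(mem_Xs_coset _ Xh er).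
rewrite in_set => /andP[Xg gJ]; have [Xh eh] := coset_repP I (w * g)%g.
have e : M g *m lam I = M (w^-1 * coset_rep I (w * g))%g *m lam I.
  by rewrite MM -mulmxA eh mulmxA -MM mulKg.
exists (coset_rep I (w * g)%g); last by rewrite (coset_rep_id Xg).
by rewrite in_set Xh (mem_Xs_coset _ Xh e).
Qed.

Lemma cperp_sub I J g : cperp I J g \subset J.
Proof. by apply/subsetP=> j; rewrite inE => /andP[]. Qed.

(** [W_D] fixes the weights outside [D], so its elements have no descent there;
  its longest one has all of [D] as descents. *)
Lemma longest_exists D : exists w, forall i, asc w i = (i \notin D).
Proof.
pose G := <<s @: D>>%g.
have fixG w : w \in G -> forall i, i \notin D -> M w *m om i = om i.
  case/gen_prodgP=> k [c Dc ->] i niD; elim: k c Dc => [|k IHk] c Dc.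
    by rewrite big_ord0 rep1 mul1mx.
  rewrite big_ord_recl MM -mulmxA IHk //; have /imsetP[j jD ->] := Dc ord0.
  rewrite rep_refl dotC (rr_dual rr); case: eqP => [ij|_]; last by rewrite scale0r subr0.
  by rewrite ij jD in niD.
case: (@arg_maxnP _ 1%g (mem G) len (group1 _)) => w /= Gw max_w.
exists w => i; apply/idP/idP=> [|niD].
  apply: contraTN => iD; rewrite -len_asc -leqNgt; apply: max_w.
  by apply: groupM Gw _; rewrite mem_gen // imset_f.
apply: contraTT isT => /ascN[/(_ _ (dominant_om i))].
rewrite dotNr -{1}(fixG w Gw i niD) dot_rep (rr_dual rr) eqxx oppr_ge0.
by rewrite ler10.
Qed.

Definition longest D : gT :=
  odflt 1%g [pick w | [forall i, asc w i == (i \notin D)]].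

Lemma asc_longest D i : asc (longest D) i = (i \notin D).
Proof.
rewrite /longest; case: pickP => [w /forallP/(_ i)/eqP//|no_w].
by have [w asc_w] := longest_exists D; have /forallP[] := no_w w; move=> j; rewrite asc_w.
Qed.

(** The value at [longest D] of [x_K] tells whether [D] and [K] are disjoint, so
  this alternating sum extracts from [x_K] whether [J] is contained in [K]; on
  the span of the [x_K] with [K] contained in [J] it is the coefficient of
  [x_J]. *)
Definition top_coef J (a : group_algebra rat gT) : rat :=
  \sum_(D : {set 'I_n} | D \subset J) (-1) ^+ #|D| * a (longest D).

Lemma top_coef_is_linear J : linear_for *%R (top_coef J).
Proof.
move=> c a b; rewrite /top_coef mulr_sumr -big_split /=; apply: eq_bigr => D _.
rewrite !ffunE /= mulrDr mulrCA; congr (_ + _).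
Qed.
HB.instance Definition _ J := GRing.isLinear.Build rat (group_algebra rat gT) rat _
  (top_coef J) (top_coef_is_linear J).

Lemma top_coef_xs J K : top_coef J (xs K) = (J \subset K)%:R.
Proof.
rewrite /top_coef -setD_eq0 -sum_subset_sign [RHS]big_mkcond [LHS]big_mkcond /=.
apply: eq_bigr => D _; rewrite xsE subsetD.
have -> : (longest D \in Xs K) = [disjoint D & K].
  apply/XsP/pred0P=> [asc_K i /=|dDK i iK].
    by apply/negP=> /andP[iD /asc_K]; rewrite asc_longest iD.
  by rewrite asc_longest; have /= := dDK i; rewrite iK andbT => ->.
by case: (D \subset J) => //=; case: [disjoint _ & _]; rewrite ?mulr1 ?mulr0.
Qed.

Lemma pos_strict l v : (forall i, 0 < dot l (al i)) -> pos v -> 0 < dot l v.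
Proof.
move=> l_gt0 [v_ge0 v_gt0].
have c_ge0 i : 0 <= dot (om i) v by apply: v_ge0; apply: dominant_om i.
have dlE u : dot u v = \sum_i dot (om i) v * dot u (al i).
  by rewrite {1}(dual_basis v) dot_sumr; apply: eq_bigr => i _; rewrite dotZr.
rewrite lt_neqAle eq_sym dlE sumr_ge0 ?andbT => [|i _]; last by rewrite mulr_ge0 // ltW.
apply: contraTneq v_gt0 => /eqP; rewrite psumr_eq0 => [/allP c0|i _]; last first.
  by rewrite mulr_ge0 // ltW.
rewrite dlE big1 ?ltxx // => i _; have /= := c0 i (mem_index_enum _).
by rewrite mulf_eq0 (gt_eqF (l_gt0 i)) orbF => /eqP->; rewrite mul0r.
Qed.

(** A strictly dominant vector pairs positively with every positive vector, so it
  may replace [rho]. *)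
Lemma asc_strict l w i : (forall i, 0 < dot l (al i)) ->
  asc w i = (0 < dot l (M w *m al i)).
Proof.
move=> l_gt0; apply/idP/idP=> [/ascP/(pos_strict l_gt0)//|].
apply: contraTT => /ascN/(pos_strict l_gt0); rewrite dotNr oppr_gt0 -leNgt.
exact: ltW.
Qed.

(** Maximize the pairing with [rho] over the orbit: a reflection in a wall that
  separates the point from the chamber would increase it. *)
Lemma dominant_exists v : exists w, dominant (M w *m v).
Proof.
pose F w := dot rho (M w *m v).
have [w _ max_w] := arg_maxP F (erefl : xpredT (1%g : gT)).
exists w; apply/forallP=> i; rewrite leNgt; apply/negP=> lt0.
have : F (s i * w)%g = F w - dot (M w *m v) (al i).
  rewrite /F (rr_M rr) -mulmxA rep_refl dotDr dotNr dotZr dot_rho mulr1.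
  by rewrite [dot (al i) _]dotC.
by have h : F (s i * w)%g <= F w := max_w _ isT; move: h => + e; rewrite e; lra.
Qed.

(** * Characters of the descent algebra and its radical *)

Definition xspan (P : pred {set 'I_n}) : {vspace group_algebra rat gT} :=
  (\sum_(K | P K) <[xs K]>)%VS.

Lemma mem_xspan (P : pred {set 'I_n}) K : P K -> xs K \in xspan P.
Proof. by move=> PK; rewrite memvE; apply: sumv_sup PK _. Qed.

Lemma xspanP (P : pred {set 'I_n}) b : b \in xspan P ->
  exists c : {set 'I_n} -> rat, b = \sum_(K | P K) c K *: xs K.
Proof.
case/memv_sumP=> u uP ->.
have /fin_all_exists[c cP] K : exists k, P K -> u K = k *: xs K.
  case: (boolP (P K)) => [PK|]; last by exists 0.
  by have /vlineP[k ->] := uP K PK; exists k.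
by exists c; apply: eq_bigr.
Qed.

Lemma sub_xspan (P Q : pred {set 'I_n}) : subpred P Q -> (xspan P <= xspan Q)%VS.
Proof.
by move=> sPQ; apply/subv_sumP=> K PK; rewrite -memvE mem_xspan // sPQ.
Qed.

Lemma descent_algebra_xspan : A = xspan predT. Proof. exact: descent_algebraE. Qed.

Lemma xs_setT : xs setT = 1.
Proof.
have -> : xs setT = \sum_(w in [set 1%g]) galg_of rat w; last by rewrite big_set1.
apply: eq_bigl => w; rewrite inE; apply/XsP/eqP=> [asc_w|->].
  by apply: asc_all => i; apply: asc_w; rewrite inE.
by move=> i _; rewrite /asc rep1 mul1mx dot_rho.
Qed.

Lemma descent_algebra1 : 1 \in A.
Proof. by rewrite -xs_setT descent_algebra_xspan mem_xspan. Qed.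

(** The right factor bounds the support: left multiplication preserves every
  span of [x_K] over an order ideal of subsets. *)
Lemma xspan_mull (P : pred {set 'I_n}) : (forall K J, K \subset J -> P J -> P K) ->
  forall a b, a \in A -> b \in xspan P -> a * b \in xspan P.
Proof.
move=> idealP a b; rewrite descent_algebra_xspan => /xspanP[c ->] /xspanP[d ->].
rewrite mulr_suml memv_suml // => I _; rewrite mulr_sumr memv_suml // => J PJ.
rewrite -scalerAl -scalerAr !memvZ // xs_mul memv_suml // => g _.
by apply: mem_xspan; apply: idealP PJ; apply: cperp_sub.
Qed.

Lemma descent_algebraM : (A * A <= A)%VS.
Proof. by apply/prodvP=> a b aA; rewrite descent_algebra_xspan; apply: xspan_mull. Qed.

(** By [mulA_low], left multiplication by [a] on [x_J] is [chi J a] modulo the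
  [x_K] with [K] strictly smaller, which is why [chi J] is multiplicative. *)
Definition chi J a : rat := top_coef J (a * xs J).

Lemma chi_is_linear J : linear_for *%R (chi J).
Proof. by move=> c a b; rewrite /chi mulrDl -scalerAl linearP. Qed.
HB.instance Definition _ J := GRing.isLinear.Build rat (group_algebra rat gT) rat _
  (chi J) (chi_is_linear J).

Lemma top_coef_low J b : b \in xspan (fun K => K \proper J) -> top_coef J b = 0.
Proof.
case/xspanP=> c ->; rewrite [LHS]linear_sum big1 // => K pKJ.
by rewrite linearZ /= top_coef_xs [J \subset K]negbTE ?mulr0 // proper_subn.
Qed.

Lemma mul_xs_low I J :
  xs I * xs J - chi J (xs I) *: xs J \in xspan (fun K => K \proper J).
Proof.
rewrite /chi xs_mul [top_coef J _]linear_sum /= scaler_suml -sumrB memv_suml // => g _.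
rewrite top_coef_xs; have := cperp_sub I J g.
rewrite subEproper => /orP[/eqP->|pJ]; first by rewrite subxx scale1r subrr mem0v.
by rewrite [J \subset _]negbTE ?proper_subn // scale0r subr0 mem_xspan.
Qed.

Lemma mulA_low a J : a \in A ->
  a * xs J - chi J a *: xs J \in xspan (fun K => K \proper J).
Proof.
rewrite descent_algebra_xspan => /xspanP[c ->]; rewrite [chi J _]linear_sum.
rewrite mulr_suml scaler_suml -sumrB memv_suml // => I _.
rewrite [X in _ - X *: _]linearZ /= -scalerAl -scalerA -scalerBr.
by rewrite memvZ // mul_xs_low.
Qed.

Lemma chiM J : {in A &, {morph chi J : a b / a * b}}.
Proof.
move=> a b aA bA; rewrite {1}/chi -mulrA.
rewrite -[b * xs J](subrK (chi J b *: xs J)) mulrDr linearD /= top_coef_low ?add0r.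
  by rewrite -scalerAr linearZ /= mulrC.
apply: xspan_mull aA (mulA_low _ bA) => K K' sKK'; exact: sub_proper_trans.
Qed.

Lemma chi1 J : chi J 1 = 1.
Proof. by rewrite /chi mul1r top_coef_xs subxx. Qed.

(** The orbit points of [lam I] orthogonal to the roots of [J], that is the fixed
  points of the parabolic subgroup of [J], are the terms of the Mackey formula
  in which [x_J] itself appears. *)
Lemma chi_xsE I J : chi J (xs I) =
  (#|[set g in Xs I | [forall j in J, dot (al j) (M g *m lam I) == 0]]|)%:R.
Proof.
rewrite /chi xs_mul linear_sum /= -sum1_card natr_sum big_mkcond [RHS]big_mkcond.
apply: eq_bigr => g _; rewrite in_set; case: (g \in _) => //=.
have -> : [forall j in J, dot (al j) (M g *m lam I) == 0] = (J \subset cperp I J g).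
  apply/forall_inP/subsetP=> [h j jJ|h j jJ]; first by rewrite inE jJ h.
  by have := h j jJ; rewrite inE jJ.
case: ifP => [_|/negbT ncd]; first by rewrite top_coef_xs; case: (J \subset _).
case: ifP => // /subsetP sJ; case/negP: ncd; apply/forall_inP=> j /sJ.
by rewrite inE => /andP[_ /eqP->].
Qed.

Definition Fil k := xspan (fun K => #|K| < k)%N.

Lemma Fil0 : Fil 0 = 0%VS.
Proof. exact: big_pred0. Qed.

Definition in_rad a := a \in A /\ forall J, chi J a = 0.

(** Since [chi J a = 0], only strictly smaller sets survive in [a * x_J]. *)
Lemma in_rad_Fil k a b : in_rad a -> b \in Fil k.+1 -> a * b \in Fil k.
Proof.
move=> [aA chi0] /xspanP[c ->]; rewrite mulr_sumr memv_suml // => K ltK.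
rewrite -scalerAr memvZ //; have := mulA_low K aA; rewrite chi0 scale0r subr0.
apply: (subvP (sub_xspan _)) => J /proper_card ltJK.
by rewrite /= in ltK *; apply: leq_trans ltJK ltK.
Qed.

Lemma in_rad_prod_Fil k (r : 'I_k -> group_algebra rat gT) b m :
  (forall i, in_rad (r i)) -> b \in Fil (k + m) -> (\prod_i r i) * b \in Fil m.
Proof.
elim: k r b m => [|k IHk] r b m nr vF; first by rewrite big_ord0 mul1r.
rewrite big_ord_recl -mulrA; apply: in_rad_Fil (nr ord0) _.
by apply: IHk => //; rewrite addnS -addSn.
Qed.

Lemma one_Fil : 1 \in Fil n.+1.
Proof. by rewrite -xs_setT mem_xspan //= cardsT card_ord. Qed.

(** The radical is contained in the kernel of every character; conversely the
  common kernel of the [chi J] is an ideal lowering the finite filtration [Fil],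
  so it is nil. *)
Lemma jacobsonE a : a \in jacobson A <-> in_rad a.
Proof.
split=> [Ja|[aA chi0]].
  split; first by case/jacobsonP: Ja.
  by move=> J; apply: (jacobson_char descent_algebra1 descent_algebraM _ _ Ja);
    [apply: chi1 | apply: chiM].
apply: (jacobson_nil descent_algebra1 descent_algebraM) => // b bA; exists n.+1.
have nba : in_rad (b * a).
  by split=> [|J]; rewrite ?chiM ?chi0 ?mulr0 //; apply: (subvP descent_algebraM); apply: memv_mul.
have := @in_rad_prod_Fil n.+1 (fun=> b * a) 1 0 (fun=> nba); rewrite addn0 => /(_ one_Fil).
by rewrite prodr_const card_ord mulr1 Fil0 memv0 => /eqP.
Qed.

Lemma jacobson_nilpotent : (jacobson A ^+ n.+1 == 0)%VS.
Proof.
suff : forall k m, (k + m = n.+1)%N -> (jacobson A ^+ k <= Fil m)%VS.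
  by move=> /(_ n.+1 0%N (addn0 _)); rewrite Fil0 subv0.
elim=> [|k IHk] m e; first by rewrite expv0 -memvE -[m]add0n e one_Fil.
rewrite expvSl; apply/prodvP=> a b /jacobsonE na bJ; apply: in_rad_Fil na _.
by apply: (subvP (IHk _ _)) bJ; rewrite addnS -addSn.
Qed.

(** Negation is a bijection between the two orbits that respects orthogonality to
  roots, and [chi K] only counts orbit points. *)
Lemma chi_opp I J K g : M g *m lam I = - lam J ->
  chi K (xs I) = chi K (xs J).
Proof.
have le_card (I' J' : {set 'I_n}) g' : M g' *m lam I' = - lam J' ->
    (#|[set h in Xs J' | [forall j in K, dot (al j) (M h *m lam J') == 0%R]]| <=
     #|[set h in Xs I' | [forall j in K, dot (al j) (M h *m lam I') == 0%R]]|)%N.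
  move=> eg; have rep h : M (coset_rep I' (h * g')%g) *m lam I' = - (M h *m lam J').
    have [_ ->] := coset_repP I' (h * g')%g.
    by rewrite (rr_M rr) -mulmxA eg mulmxN.
  rewrite -(@card_in_imset _ _ (fun h => coset_rep I' (h * g')%g)); last first.
    move=> h h'; rewrite in_set => /andP[Xh _]; rewrite in_set => /andP[Xh' _] e.
    by apply: (Xs_inj Xh Xh'); apply: oppr_inj; rewrite -!rep e.
  apply/subset_leq_card/subsetP=> _ /imsetP[h hJ ->].
  rewrite in_set in hJ; case/andP: hJ => _ /forall_inP perp.
  rewrite in_set (coset_repP _ _).1; apply/forall_inP=> j jK.
  by rewrite rep dotNr oppr_eq0 perp.
move=> eg; rewrite !chi_xsE; congr (_%:R); apply/eqP; rewrite eqn_leq (le_card _ _ _ eg).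
rewrite (le_card J I g^-1%g) //.
by rewrite -[lam J]opprK -eg mulmxN repVK.
Qed.

(** * The group algebra acting by matrices *)

Definition galg_mx a : 'M[rat]_n := \sum_w (a w : rat) *: M w.

Lemma galg_mx_is_linear : linear galg_mx.
Proof.
move=> c a b; rewrite /galg_mx scaler_sumr -big_split; apply: eq_bigr => w _ /=.
by rewrite !ffunE scalerDl scalerA.
Qed.
HB.instance Definition _ := GRing.isLinear.Build rat (group_algebra rat gT) 'M[rat]_n _
  galg_mx galg_mx_is_linear.

Lemma galg_mx_galg g : galg_mx (galg_of rat g) = M g.
Proof.
rewrite /galg_mx (bigD1 g) //= ffunE eqxx scale1r big1 ?addr0 // => w /negPf wg.
by rewrite ffunE wg scale0r.
Qed.

Lemma galg_sum a : a = \sum_w (a w : rat) *: galg_of rat w.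
Proof.
apply/ffunP=> g; rewrite sum_ffunE (bigD1 g) //= big1 => [|w /negPf wg].
  by rewrite addr0 ffunE /= ffunE eqxx /GRing.scale /= mulr1.
by rewrite ffunE /= ffunE eq_sym wg scaler0.
Qed.

Lemma galg_mxM a b : galg_mx (a * b) = galg_mx a *m galg_mx b.
Proof.
rewrite {1}(galg_sum a) {1}(galg_sum b) mulr_suml linear_sum /= [galg_mx a]/galg_mx mulmx_suml.
apply: eq_bigr => g _; rewrite mulr_sumr linear_sum /= [galg_mx b]/galg_mx mulmx_sumr.
apply: eq_bigr => h _; rewrite -scalerAl -scalerAr -galg_ofM !linearZ /= galg_mx_galg.
by rewrite (rr_M rr) -scalemxAl !scalerA mulrC.
Qed.

Lemma galg_mx1 : galg_mx 1 = 1%:M.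
Proof. by rewrite [LHS]galg_mx_galg rep1. Qed.

Lemma galg_mx_xs I : galg_mx (xs I) = \sum_(w in Xs I) M w.
Proof. by rewrite linear_sum; apply: eq_bigr => w _; apply: galg_mx_galg. Qed.

(** * Groups containing minus the identity *)

Section CentralInvolution.
Variable z : gT.
Hypothesis Mz : M z = - 1%:M.

Let Z : group_algebra rat gT := galg_of rat z.

Lemma galg_of_mull b g w : (galg_of rat g * b) w = b (g^-1 * w)%g.
Proof.
rewrite ffunE (bigD1 g) //= ffunE eqxx mul1r big1 ?addr0 // => h /negPf hg.
by rewrite ffunE hg mul0r.
Qed.

Lemma galg_of_mulr b g w : (b * galg_of rat g) w = b (w * g^-1)%g.
Proof.
rewrite ffunE (bigD1 (w * g^-1)%g) //= ffunE invMg invgK mulgKV eqxx mulr1.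
rewrite big1 ?addr0 // => h hg; rewrite ffunE; case: eqP => [e|_]; last by rewrite mulr0.
by case/eqP: hg; rewrite -e invMg invgK mulKVg.
Qed.

Lemma z_central w : (z * w = w * z)%g.
Proof. by apply: rep_inj; rewrite !(rr_M rr) Mz mulNmx mulmxN mul1mx mulmx1. Qed.

Lemma zV : (z^-1 = z)%g.
Proof.
apply: (mulgI z); rewrite mulgV; apply: rep_inj.
by rewrite (rr_M rr) Mz mulNmx mul1mx opprK rep1.
Qed.

Lemma Z_comm a : Z * a = a * Z.
Proof. by apply/ffunP=> w; rewrite galg_of_mull galg_of_mulr zV z_central. Qed.

Lemma asc_z w i : asc (z * w)%g i = ~~ asc w i.
Proof.
rewrite /asc (rr_M rr) Mz mulNmx mul1mx mulNmx dotNr oppr_gt0 -leNgt.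
apply/idP/idP=> [/ltW//|]; rewrite le_eqVlt => /orP[/eqP d0|//].
have [/ascP|/ascN] := boolP (asc w i); move/pos_gt0; rewrite ?dotNr.
  by rewrite d0 ltxx.
by rewrite d0 oppr0 ltxx.
Qed.

(** Left multiplication by the central involution exchanges ascents and
  descents; inclusion-exclusion then expands it on the [x_K]. *)
Lemma Z_xs J : Z * xs J = \sum_(K : {set 'I_n} | K \subset J) (-1) ^+ #|K| *: xs K.
Proof.
apply/ffunP=> w; rewrite galg_of_mull xsE zV sum_ffunE.
pose D := [set i | asc w i].
have XD K : (w \in Xs K) = (K \subset D).
  by apply/XsP/subsetP=> h i /h; rewrite inE.
have -> : ((z * w)%g \in Xs J) = (J :&: D == set0).
  apply/XsP/eqP=> [h|h i iJ].
    apply/setP=> i; rewrite !inE; apply/negbTE/negP=> /andP[/h].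
    by rewrite asc_z => /negPf->.
  by rewrite asc_z; apply/negP=> asc_i; have /setP/(_ i) := h; rewrite !inE iJ asc_i.
rewrite -sum_subset_sign [RHS]big_mkcond [LHS]big_mkcond /=; apply: eq_bigr => K _.
rewrite subsetI; case: (K \subset J) => //=; rewrite ffunE xsE XD /GRing.scale /=.
by case: (K \subset D); rewrite ?mulr1 ?mulr0.
Qed.

Lemma Z_Fil k b : b \in Fil k.+1 -> Z * b - (-1) ^+ k *: b \in Fil k.
Proof.
case/xspanP=> c ->; rewrite mulr_sumr scaler_sumr -sumrB memv_suml // => J ltJ.
rewrite -scalerAr scalerA mulrC -scalerA -scalerBr memvZ //.
rewrite Z_xs (bigD1 J) //= -addrA addrC.
have -> : \sum_(i : {set 'I_n} | (i \subset J) && (i != J)) (-1) ^+ #|i| *: xs i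
            - (-1) ^+ k *: xs J + (-1) ^+ #|J| *: xs J =
          \sum_(i : {set 'I_n} | (i \subset J) && (i != J)) (-1) ^+ #|i| *: xs i
            + ((-1) ^+ #|J| - (-1) ^+ k) *: xs J.
  by rewrite scalerBl addrAC addrA.
rewrite rpredD //.
  rewrite memv_suml // => K /andP[sKJ neqKJ]; rewrite memvZ // mem_xspan //=.
  by apply: leq_trans (_ : #|J| <= k)%N; rewrite // proper_card // properEneq neqKJ.
have := ltJ; rewrite ltnS leq_eqVlt => /orP[/eqP->|ltJk].
  by rewrite subrr scale0r mem0v.
by rewrite memvZ // mem_xspan.
Qed.

(** Two steps at once: [a * b] and [b] have the same parity under [Z], whereas
  consecutive layers have opposite ones. *)
Lemma in_rad_Fil2 k a b : in_rad a -> b \in Fil k.+2 -> a * b \in Fil k.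
Proof.
move=> na vF; have av := in_rad_Fil na vF.
have h1 := in_rad_Fil na (Z_Fil vF); have h2 := Z_Fil av.
(* Both differences lie in [Fil k], and since [Z] is central they differ by
   [2 (-1)^k a b]. *)
have e : a * b = ((-1) ^+ k / 2) *:
    ((a * (Z * b - (-1) ^+ k.+1 *: b)) - (Z * (a * b) - (-1) ^+ k *: (a * b))).
  rewrite exprS mulN1r scaleNr opprK mulrDr -scalerAr !mulrA -Z_comm opprB.
  rewrite [X in _ *: X]addrC addrA subrK -scalerDl scalerA -[LHS]scale1r.
  by congr (_ *: _); have := sqrr_sign rat k; rewrite expr2 => sq1; field: sq1.
by rewrite e memvZ // rpredB.
Qed.

Lemma chi_xs_neq0 I : chi I (xs I) != 0.
Proof.
rewrite chi_xsE pnatr_eq0 -lt0n; apply/card_gt0P; exists 1%g.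
rewrite in_set; apply/andP; split.
  by apply/XsP=> i _; rewrite /asc rep1 mul1mx dot_rho.
by apply/forall_inP=> j jI; rewrite rep1 mul1mx dotC dot_lam jI.
Qed.

(** The sign of the one remaining pairing decides. *)
Lemma dominant_dichotomy k (v : 'cV[rat]_n) : (forall j, j != k -> dot (al j) v = 0) ->
  dominant v \/ dominant (- v).
Proof.
move=> v0; have [c_ge0|c_lt0] := leP 0 (dot (al k) v); [left|right];
  apply/forallP=> j; rewrite ?dotNl dotC; have [->|/v0->] := eqVneq j k; rewrite ?oppr0 //.
by rewrite oppr_ge0 ltW.
Qed.

(** An orbit point of [lam I] orthogonal to all simple roots but one is dominant
  up to sign; as the orbit is stable under negation, it is [lam I] up to sign. *)
Lemma chi_max_xs k I : chi (~: [set k]) (xs I) != 0 -> ~: [set k] \subset I.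
Proof.
rewrite chi_xsE pnatr_eq0 -lt0n => /card_gt0P[g].
rewrite in_set => /andP[_ /forall_inP perp].
have perp_j j : j != k -> dot (al j) (M g *m lam I) = 0.
  by move=> jk; apply/eqP/perp; rewrite !inE.
suff [e|e] : M g *m lam I = lam I \/ - (M g *m lam I) = lam I.
- apply/subsetP=> j; rewrite !inE => /perp_j/eqP; rewrite e dotC dot_lam.
  by case: (j \in I); rewrite ?oner_eq0.
- apply/subsetP=> j; rewrite !inE => /perp_j/eqP; rewrite -[M g *m _]opprK e dotNr oppr_eq0.
  by rewrite dotC dot_lam; case: (j \in I); rewrite ?oner_eq0.
have zg : M (z * g)%g *m lam I = - (M g *m lam I).
  by rewrite (rr_M rr) Mz mulNmx mul1mx mulNmx.
have dl := dominant_lam I.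
have [d|d] := dominant_dichotomy perp_j; [left|right].
  by apply: (dominant_orbit dl).
by rewrite -zg; apply: (dominant_orbit dl); rewrite zg.
Qed.

Lemma chi_setT_xs I : chi setT (xs I) != 0 -> I = setT.
Proof.
rewrite chi_xsE pnatr_eq0 -lt0n => /card_gt0P[g].
rewrite in_set => /andP[_ /forall_inP perp].
have lam0 : lam I = 0.
  rewrite -(repVK g (lam I)); set v := M g *m _ in perp *.
  have -> : v = 0; last by rewrite mulmx0.
  apply: dot_eq0; rewrite {2}(dual_basis v) dot_sumr big1 // => i _.
  by rewrite dotZr [dot v _]dotC (eqP (perp i (in_setT _))) mulr0.
apply/setP=> i; rewrite inE; have := dot_lam I i; rewrite lam0 dotC /dot mulmx0 mxE.
by case: (i \in I) => // /esym/eqP; rewrite oner_eq0.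
Qed.

(** The characters of the full set and of the complements of points form, on the
  corresponding [x_I], a triangular system with nonzero diagonal, so the radical
  has no component on them. *)
Lemma in_rad_Fil_pred a : in_rad a -> a \in Fil n.-1.
Proof.
case; rewrite descent_algebra_xspan => /xspanP[c ->] chi0.
have chi_sum J : chi J (\sum_I c I *: xs I) = \sum_I c I * chi J (xs I).
  by rewrite [LHS]linear_sum; apply: eq_bigr => I _; rewrite [LHS]linearZ.
have cT : c setT = 0.
  have := chi0 setT; rewrite chi_sum (bigD1 setT) //= big1 => [|I neqI].
    by rewrite addr0 => /eqP; rewrite mulf_eq0 (negPf (chi_xs_neq0 _)) orbF => /eqP.
  apply/eqP; rewrite mulf_eq0 orbC; apply/orP; left.
  by apply: contraR neqI => /chi_setT_xs/eqP.
have cmax k : c (~: [set k]) = 0.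
  have := chi0 (~: [set k]); rewrite chi_sum (bigD1 (~: [set k])) //= big1 => [|I neqI].
    by rewrite addr0 => /eqP; rewrite mulf_eq0 (negPf (chi_xs_neq0 _)) orbF => /eqP.
  have [->|/eqP neqT] := eqVneq I setT; first by rewrite cT mul0r.
  apply/eqP; rewrite mulf_eq0 orbC; apply/orP; left; apply: contraR neqI => /chi_max_xs sub.
  rewrite eq_sym eqEsubset sub /=; apply/subsetP=> i iI; rewrite !inE; apply/negP=> /eqP ik.
  case: neqT; apply/setP=> j; rewrite inE; have [->|jk] := eqVneq j k; first by rewrite -ik.
  by apply: (subsetP sub); rewrite !inE.
rewrite memv_suml // => I _; have [ltI|leI] := ltnP #|I| n.-1.
  by rewrite memvZ // mem_xspan.
have [I0|[k kI]] := set_0Vmem (~: I).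
  have -> : I = setT by rewrite -[I]setCK I0 setC0.
  by rewrite cT scale0r mem0v.
have -> : I = ~: [set k].
  apply/eqP; rewrite -(inj_eq (can_inj (@setCK _))) setCK eq_sym eqEcard sub1set kI cards1 /=.
  rewrite -(leq_add2l #|I|) cardsC card_ord addn1.
  by apply: leq_trans (leqSpred n) _; rewrite ltnS.
by rewrite cmax scale0r mem0v.
Qed.

Lemma jacobson_exp_Fil k : (jacobson A ^+ k.+1 <= Fil (n.-1 - k.*2))%VS.
Proof.
elim: k => [|k IHk].
  by rewrite expv1 subn0; apply/subvP=> a /jacobsonE/in_rad_Fil_pred.
rewrite expvSl; apply/prodvP=> a b /jacobsonE na /(subvP IHk) bF.
have [lt2|le2] := ltnP (n.-1 - k.*2) 2; last first.
  by apply: (in_rad_Fil2 na); rewrite -addn2 doubleS -addn2 subnDA subnK.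
have -> : (n.-1 - k.+1.*2 = 0)%N by move: lt2; rewrite doubleS; lia.
have : b \in Fil 1 by apply: (subvP (sub_xspan _)) bF => J /= /leq_trans; apply.
by move=> bF1; refine (in_rad_Fil na bF1).
Qed.

Lemma jacobson_exp_sub k : (jacobson A ^+ k.+1 <= jacobson A)%VS.
Proof.
case: k => [|k]; first by rewrite expv1.
have AJ : (jacobson A <= A)%VS by apply/subvP=> a /jacobsonE[].
have AAM := descent_algebraM.
have JA : (jacobson A ^+ k.+1 <= A)%VS.
  elim: k => [|k IHk]; first by rewrite expv1.
  by rewrite expvSl; apply: subv_trans AAM; apply: prodvS.
rewrite expvSl; apply/prodvP=> a b /jacobsonE[aA a0] /(subvP JA) bA.
apply/jacobsonE; split=> [|J]; first by apply: (subvP AAM); apply: memv_mul.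
by rewrite chiM // a0 mul0r.
Qed.

(** [xs set0] is not in the radical, as [chi set0] does not kill it. *)
Lemma jacobson_Fil1 a : a \in jacobson A -> a \in Fil 1 -> a = 0.
Proof.
case/jacobsonE=> _ a0 /xspanP[c def_a]; have := a0 set0.
have e : a = c set0 *: xs set0.
  rewrite def_a (bigD1 set0) ?cards0 //= big1 ?addr0 // => K.
  by rewrite ltnS leqn0 cards_eq0 => /andP[->].
rewrite e [chi _ _]linearZ /= => /eqP; rewrite mulf_eq0 (negPf (chi_xs_neq0 _)) orbF.
by move/eqP->; rewrite scale0r.
Qed.

(** One factor lies in [Fil n.-1], and each further factor goes down by two. For
  [n] odd this ends in [Fil 0], and for [n] even in [Fil 1], which meets the
  radical in 0. *)
Lemma jacobson_exp_uphalf : (0 < n)%N -> (jacobson A ^+ uphalf n == 0)%VS.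
Proof.
move=> n0; have -> : uphalf n = (uphalf n).-1.+1 by case: (n) n0.
rewrite -subv0; apply/subvP=> a aJ; rewrite memv0; apply/eqP/jacobson_Fil1.
  exact: (subvP (jacobson_exp_sub _)) aJ.
apply: (subvP (sub_xspan _)) ((subvP (jacobson_exp_Fil _)) _ aJ) => J /= /leq_trans.
by apply; move: (uphalf_half n) (odd_double_half n); lia.
Qed.

End CentralInvolution.

End ReflectionGroup.

(** * Row vectors as polynomials *)

Section RowPolynomials.
Variable N : nat.
Local Notation n := N.+1.
Implicit Types (y : 'rV[rat]_n).

Definition rowp y : {poly rat} := \sum_j y 0 j *: 'X^j.

Lemma coef_rowp y (j : 'I_n) : (rowp y)`_j = y 0 j.
Proof.
rewrite coef_sum (bigD1 j) //= coefZ coefXn eqxx mulr1 big1 ?addr0 // => i ij.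
by rewrite coefZ coefXn [_ == _ :> nat]eq_sym -[_ == _]/(i == j) (negPf ij) mulr0.
Qed.

Lemma rowp_inj : injective rowp.
Proof. by move=> y y' e; apply/rowP=> j; rewrite -!coef_rowp e. Qed.

Lemma rowp_is_linear : linear rowp.
Proof.
move=> c y y'; rewrite /rowp scaler_sumr -big_split; apply: eq_bigr => j _ /=.
by rewrite !mxE scalerDl scalerA.
Qed.
HB.instance Definition _ := GRing.isLinear.Build rat 'rV[rat]_n {poly rat} _
  rowp rowp_is_linear.

Lemma rowp_mul y (B : 'M[rat]_n) : rowp (y *m B) = \sum_j y 0 j *: rowp (row j B).
Proof. by rewrite mulmx_sum_row linear_sum; apply: eq_bigr => j _; rewrite linearZ. Qed.

Lemma rowp_delta (j : 'I_n) : rowp (delta_mx 0 j) = 'X^j.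
Proof.
rewrite /rowp (bigD1 j) //= mxE !eqxx scale1r big1 ?addr0 // => i /negPf ij.
by rewrite mxE ij scale0r.
Qed.

(** The coefficients of the polynomial [X^(N - m) (X - 1)^m], with the leading one
  replaced by 0. *)
Definition yv m : 'rV[rat]_n :=
  \row_j (if (j < N)%N then (-1) ^+ (N - j) * 'C(m, N - j)%:R else 0).

Definition last_row : 'rV[rat]_n := delta_mx 0 ord_max.

Lemma binomial_hom (R : comNzRingType) (a b : R) m : (m <= N)%N ->
  \sum_(i < n) ((-1) ^+ i * 'C(m, i)%:R) * (a ^+ (N - i) * b ^+ i) = a ^+ (N - m) * (a - b) ^+ m.
Proof.
move=> le_mN; rewrite exprBn mulr_sumr.
rewrite (big_ord_widen n (fun i =>
  a ^+ (N - m) * ((-1) ^+ i * a ^+ (m - i) * b ^+ i *+ 'C(m, i)))) //.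
rewrite [RHS]big_mkcond; apply: eq_bigr => i _; case: ltnP => [le_im|lt_mi]; last first.
  by rewrite bin_small // mulr0 mul0r.
have -> : (N - i = (N - m) + (m - i))%N by lia.
by rewrite exprD -mulr_natr; ring.
Qed.

Lemma rowp_yv m : (m <= N)%N -> rowp (yv m + last_row) = 'X^(N - m) * ('X - 1) ^+ m.
Proof.
move=> le_mN; rewrite -(binomial_hom _ _ le_mN) /rowp (reindex_inj rev_ord_inj) /=.
apply: eq_bigr => i _; rewrite !mxE /= -val_eqE /= !subSS expr1n mulr1 -mul_polyC.
have iN := ltn_ord i; rewrite ltnS in iN; rewrite subKn //.
case: (posnP i) => [->|i_gt0].
  by rewrite !subn0 ltnn eqxx bin0 expr0 add0r !mul1r.
have -> : (N - i < N)%N by lia.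
have -> : (N - i == N)%N = false by lia.
by rewrite addr0 rmorphM /= rmorphXn /= rmorphN1 rmorph_nat.
Qed.

End RowPolynomials.

(** * The reflection representation of type D *)

Section Involutions.
Variables (G : groupType) (x y : G).
Hypotheses (x2 : (x * x = 1)%g) (y2 : (y * y = 1)%g).

Let Vx : (x^-1 = x)%g. Proof. by apply: (mulgI x); rewrite mulgV x2. Qed.
Let Vy : (y^-1 = y)%g. Proof. by apply: (mulgI y); rewrite mulgV y2. Qed.

Lemma invol_comm : ((x * y) ^+ 2 = 1)%g <-> (x * y = y * x)%g.
Proof.
have -> : (y * x = (x * y)^-1)%g by rewrite invMg Vx Vy.
rewrite !expgS expg0 mulg1; split=> [e|{1}->]; last by rewrite mulVg.
by apply: (mulgI (x * y)%g); rewrite mulgV e.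
Qed.

Lemma invol_braid : ((x * y) ^+ 3 = 1)%g <-> (x * y * x = y * x * y)%g.
Proof.
have V : (y * x * y = (y * x * y)^-1)%g by rewrite !invMg Vx Vy mulgA.
have -> : ((x * y) ^+ 3 = (x * y * x) * (y * x * y))%g.
  by rewrite !expgS expg0 mulg1 !mulgA.
rewrite {1}V; split=> [e|->]; last by rewrite mulgV.
by apply: (mulIg (y * x * y)^-1%g); rewrite e mulgV.
Qed.

End Involutions.

(** Coxeter systems are characterized by maps to arbitrary groups; the invertible
  matrices are made into one. *)
Record glmx n := GLmx { glval :> 'M[rat]_n; glvalP : glval \in unitmx }.
HB.instance Definition _ n := [isSub for @glval n].
HB.instance Definition _ n := [Choice of glmx n by <:].

Section GLmxGroup.
Variable n : nat.
Implicit Types x y : glmx n.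

Fact glmx1_subproof : 1%:M \in @unitmx rat n. Proof. exact: unitmx1. Qed.
Fact glmxM_subproof x y : glval x *m glval y \in unitmx.
Proof. by rewrite unitmx_mul !glvalP. Qed.
Fact glmxV_subproof x : invmx (glval x) \in unitmx.
Proof. by rewrite unitmx_inv glvalP. Qed.

Definition glmx1 := GLmx glmx1_subproof.
Definition glmxM x y := GLmx (glmxM_subproof x y).
Definition glmxV x := GLmx (glmxV_subproof x).

Fact glmxA : associative glmxM.
Proof. by move=> x y z; apply: val_inj; apply: mulmxA. Qed.
Fact glmx1M : left_id glmx1 glmxM.
Proof. by move=> x; apply: val_inj; apply: mul1mx. Qed.
Fact glmxM1 : right_id glmx1 glmxM.
Proof. by move=> x; apply: val_inj; apply: mulmx1. Qed.
Fact glmxVM : left_inverse glmx1 glmxV glmxM.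
Proof. by move=> x; apply: val_inj; apply: mulVmx (glvalP x). Qed.
Fact glmxMV : right_inverse glmx1 glmxV glmxM.
Proof. by move=> x; apply: val_inj; apply: mulmxV (glvalP x). Qed.

HB.instance Definition _ :=
  isGroup.Build (glmx n) glmxA glmx1M glmxM1 glmxVM glmxMV.

End GLmxGroup.

Section TypeDRoots.
Variable N : nat.
Hypothesis N2 : (2 <= N)%N.
Local Notation n := N.+1.
Local Notation x_ v k := (v (inord k : 'I_n) (0 : 'I_1)).
Implicit Types (u v : 'cV[rat]_n) (i j : 'I_n).

Definition evec (k : nat) : 'cV[rat]_n := delta_mx (inord k) 0.

Definition alD (i : 'I_n) : 'cV[rat]_n :=
  if (i < N)%N then evec i - evec i.+1 else evec N.-1 + evec N.

(** The fundamental weights: partial sums of the standard basis, except for the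
  two half-spin weights attached to the last two nodes. *)
Definition omD (i : 'I_n) : 'cV[rat]_n :=
  \col_k (if (i.+1 < N)%N then (k <= i)%:R
          else if ((i < N) && (k == N :> nat))%N then - 1 / 2 else 1 / 2).

Lemma dot_evec v k : dot v (evec k) = x_ v k.
Proof.
rewrite dotE (bigD1 (inord k)) //= mxE !eqxx mulr1 big1 ?addr0 // => i /negPf ik.
by rewrite mxE ik mulr0.
Qed.

Lemma dot_alD v i : dot v (alD i) =
  if (i < N)%N then x_ v i - x_ v i.+1 else x_ v N.-1 + x_ v N.
Proof. by rewrite /alD; case: ifP; rewrite ?dotDr ?dotNr !dot_evec. Qed.

Lemma inord_eqE a b : (a <= N)%N -> (b <= N)%N -> (inord a == inord b :> 'I_n) = (a == b).
Proof. by move=> aN bN; rewrite -val_eqE /= !inordK. Qed.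

Lemma evecE a b : (a <= N)%N -> (b <= N)%N -> x_ (evec a) b = (b == a)%:R.
Proof. by move=> aN bN; rewrite mxE inord_eqE // eqxx andbT. Qed.

Lemma alDE i k : (k <= N)%N -> x_ (alD i) k =
  if (i < N)%N then (k == i)%:R - (k == i.+1)%:R else (k == N.-1)%:R + (k == N)%:R.
Proof.
move=> kN; have iN := ltn_ord i; rewrite ltnS in iN.
have addE u v c : (u + v) c 0 = u c 0 + v c 0 by rewrite mxE.
have oppE v c : (- v) c 0 = - v c 0 by rewrite mxE.
rewrite /alD; case: ifP => ltiN; rewrite addE ?oppE !evecE //.
exact: leq_pred.
Qed.

Lemma coxD_edge_lt i j : (i < N)%N -> (j < N)%N -> coxD_edge n i j = (j == i.+1 :> nat).
Proof.
move=> iN jN; rewrite /coxD_edge ltnS jN andbT.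
by rewrite [(j.+1 == n)]eqSS (ltn_eqF jN) andbF orbF.
Qed.

Lemma coxD_edge_last i j : (i < N)%N -> j = N :> nat ->
  coxD_edge n i j || coxD_edge n j i = (i.+2 == N).
Proof.
by move=> iN jN; rewrite /coxD_edge jN; lia.
Qed.

Lemma gram_alD i j : dot (alD i) (alD j) =
  if i == j then 2 else if coxD_edge n i j || coxD_edge n j i then -1 else 0.
Proof.
have key (a b : 'I_n) : (a < N)%N -> b = N :> nat ->
      dot (alD a) (alD b) = if a.+2 == N then -1 else 0.
  move=> aN bN; rewrite dot_alD bN ltnn !alDE ?aN //; last lia.
  have -> : (N == a) = false by lia.
  have -> : (N.-1 == a) = (a.+1 == N) by lia.
  have -> : (N == a.+1) = (a.+1 == N) by lia.
  have -> : (N.-1 == a.+1) = (a.+2 == N) by lia.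
  by have [e|_] := eqVneq a.+2 N; [have -> : (a.+1 == N) = false by lia|]; rewrite /=; ring.
have iN := ltn_ord i; have jN := ltn_ord j; rewrite ltnS leq_eqVlt in iN.
rewrite ltnS leq_eqVlt in jN.
case/orP: iN => [/eqP iN|iN]; case/orP: jN => [/eqP jN|jN].
- rewrite -val_eqE /= iN jN eqxx dot_alD jN ltnn !alDE //; last lia.
  rewrite iN ltnn !eqxx; have -> : (N == N.-1) = false by lia.
  by have -> : (N.-1 == N) = false by lia.
- rewrite dotC key // orbC coxD_edge_last // -val_eqE /=.
  by have -> : (i == j :> nat) = false by lia.
- rewrite key // coxD_edge_last // -val_eqE /=.
  by have -> : (i == j :> nat) = false by lia.
rewrite !coxD_edge_lt // dot_alD jN !alDE ?iN //; last exact: ltnW.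
rewrite -val_eqE /= !eqSS; case: (ltngtP i j) => [ij|ij|->] /=.
- have -> : (j.+1 == i) = false by lia.
  have -> : (i == j.+1 :> nat) = false by lia.
  by case: eqP => _; rewrite /= ; ring.
- have -> : (j == i.+1 :> nat) = false by lia.
  have -> : (j.+1 == i) = (i == j.+1 :> nat) by lia.
  by case: (i == j.+1 :> nat); rewrite /=; ring.
have -> : (j == j.+1 :> nat) = false by lia.
have -> : (j.+1 == j :> nat) = false by lia.
by rewrite /=; ring.
Qed.

Lemma omD_dual i j : dot (omD i) (alD j) = (i == j)%:R.
Proof.
have iN := ltn_ord i; have jN := ltn_ord j; rewrite ltnS in iN; rewrite ltnS in jN.
rewrite dot_alD -val_eqE /= !mxE; case: ifP => ltj; rewrite !inordK ?ltnS //; try lia.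
  have -> : (j == N :> nat) = false by lia.
  case: ifP => lti.
    by case: (ltngtP i j) => ij; rewrite /= ?subrr ?subr0.
  have [ltiN|leNi] := ltnP i N; rewrite /=; last first.
    by have -> : (i == j :> nat) = false by lia; rewrite subrr.
  have -> : (j.+1 == N) = (i == j :> nat) by lia.
  by case: (i == j :> nat); rewrite /=; field.
have -> : j = N :> nat by lia.
have -> : (N.-1 == N) = false by lia.
rewrite andbF eqxx andbT; case: ifP => lti.
  have -> : (N.-1 <= i)%N = false by lia.
  have -> : (N <= i)%N = false by lia.
  by have -> : (i == N :> nat) = false by lia; rewrite addr0.
have [ltiN|leNi] := ltnP i N.
  by have -> : (i == N :> nat) = false by lia; rewrite /=; field.
by have -> : (i == N :> nat) = true by lia; rewrite /=; field.
Qed.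

Lemma norm_alD i : dot (alD i) (alD i) = 2.
Proof. by rewrite gram_alD eqxx. Qed.

Lemma reflmx_unit i : reflmx (alD i) \in unitmx.
Proof. by have /mulmx1_unit[] := reflmx_invol (norm_alD i). Qed.

Definition reflD i : glmx n := GLmx (reflmx_unit i).

Lemma reflD_invol i : (reflD i * reflD i = 1)%g.
Proof. by apply: val_inj; apply: reflmx_invol (norm_alD i). Qed.

Lemma reflD_order i j : ((reflD i * reflD j) ^+ coxD_mx n i j = 1)%g.
Proof.
rewrite /coxD_mx; have := gram_alD i j; rewrite -val_eqE /=.
case: eqP => [/val_inj-> _|_]; first by rewrite expg1 reflD_invol.
case: ifP => _ dij.
  apply/(invol_braid (reflD_invol i) (reflD_invol j)); apply: val_inj.
  exact: reflmx_braid (norm_alD i) (norm_alD j) dij.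
apply/(invol_comm (reflD_invol i) (reflD_invol j)); apply: val_inj.
exact: reflmx_comm dij.
Qed.

End TypeDRoots.

(** Both the representation and the parity come from the universal property, the
  latter applied to the group of order two. *)
Lemma typeD_reflection_rep (N : nat) (gT : finGroupType) (S : {set gT}) (s : 'I_N.+1 -> gT) :
  (2 <= N)%N -> coxeter_system S -> injective s -> S = [set s i | i : 'I_N.+1] ->
  (forall i j, #[s i * s j]%g = coxD_mx N.+1 i j) ->
  exists M : gT -> 'M[rat]_N.+1, reflection_rep s M (@alD N) (@omD N).
Proof.
move=> N2 [genS ordS univ] s_inj defS ordss.
have sS i : s i \in S by rewrite defS imset_f.
have s2 i : (s i * s i = 1)%g.
  by have := ordss i i; rewrite /coxD_mx eqxx => /eqP; rewrite order_eq1 => /eqP.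
pose f w := if [pick i | s i == w] is Some i then reflD N2 i else 1%g.
have fs i : f (s i) = reflD N2 i.
  rewrite /f; case: pickP => [j /eqP/s_inj->//|/(_ i)]; by rewrite eqxx.
have [|phi phiM phiS] := univ (glmx N.+1) f.
  move=> x y; rewrite defS => /imsetP[i _ ->] /imsetP[j _ ->].
  by rewrite !fs ordss reflD_order.
have [|sg sgM sgS] := univ {perm bool} (fun=> tperm true false).
  by move=> x y _ _; rewrite tperm2 expg1n.
exists (fun w => glval (phi w)); split.
- by rewrite -defS.
- exact: s2.
- exists (fun w => odd_perm (sg w)) => [x y|i]; first by rewrite sgM odd_permM.
  by rewrite sgS // odd_tperm.
- by move=> x y; rewrite phiM.
- by move=> i; rewrite phiS // fs.
- exact: norm_alD.
- move=> i j neq_ij; have := gram_alD N2 i j; have := ordss i j; rewrite /coxD_mx.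
  rewrite -[i == j :> nat]/(i == j) (negPf neq_ij); case: ifP => _ o g; [right|left]; split=> //.
    by apply/invol_braid; rewrite ?s2 // -o expg_order.
  by apply/invol_comm; rewrite ?s2 // -o expg_order.
exact: omD_dual.
Qed.

(** * Even signed permutations *)

(** Monotonicity gives [i <= p i] and, for the inverse, [p i <= i]. *)
Lemma perm_mono_id n (p : {perm 'I_n}) :
  (forall i j : 'I_n, (i < j)%N -> (p i < p j)%N) -> p = 1%g.
Proof.
have lower (q : {perm 'I_n}) :
    (forall i j : 'I_n, (i < j)%N -> (q i < q j)%N) -> forall i : 'I_n, (i <= q i)%N.
  move=> q_mono [i lt_in] /=; elim: i lt_in => // i IHi lt_in.
  have lt_in' := ltnW lt_in; apply: leq_ltn_trans (IHi lt_in') _.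
  exact: q_mono.
move=> p_mono; apply/permP=> i; rewrite perm1; apply/val_inj/eqP; rewrite eqn_leq lower //= andbT.
have := @lower p^-1%g _ (p i); rewrite permK; apply=> a b lt_ab.
rewrite ltnNge; apply/negP; rewrite leq_eqVlt => /orP[/eqP/val_inj/perm_inj e|/p_mono].
  by rewrite e ltnn in lt_ab.
by rewrite !permKV ltnNge (ltnW lt_ab).
Qed.

Section TypeD.
Variables (N : nat) (gT : finGroupType) (s : 'I_N.+1 -> gT) (M : gT -> 'M[rat]_N.+1).
Hypothesis N2 : (2 <= N)%N.
Hypothesis rr : reflection_rep s M (@alD N) (@omD N).
Local Notation n := N.+1.
Local Notation A := (descent_algebra [set s i | i : 'I_n]).
Local Notation Xs := (Xs M (@alD N) (@omD N)).
Local Notation xs := (xs M (@alD N) (@omD N)).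
Local Notation asc := (asc M (@alD N) (@omD N)).
Local Notation lam := (lam (@omD N)).
Local Notation chi := (chi M (@alD N) (@omD N)).
Local Notation in_rad := (in_rad s M (@alD N) (@omD N)).
Local Notation galg_mx := (galg_mx M).
Local Notation yv := (yv N).
Local Notation last_row := (last_row N).
Implicit Types (w u : gT) (p : {perm 'I_n}) (E D : {set 'I_n}).

Definition acts_as w p E := forall (v : 'cV_n) k, (M w *m v) k 0 = (-1) ^+ (k \in E) * v (p k) 0.

Lemma acts_as_refl i : exists p E, acts_as (s i) p E /\ ~~ odd #|E|.
Proof.
have iN := ltn_ord i; rewrite ltnS leq_eqVlt in iN.
case/orP: iN => [/eqP iN|iN]; last first.
  have neq : inord i != inord i.+1 :> 'I_n by rewrite inord_eqE ?(ltnW iN) //; lia.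
  exists (tperm (inord i) (inord i.+1)), set0; rewrite cards0; split=> // v k.
  rewrite (rep_refl rr) dotC dot_alD iN in_set0 mul1r /alD iN !mxE !andbT.
  case: tpermP => [->|->|/eqP/negPf-> /eqP/negPf->]; rewrite ?eqxx ?(negPf neq).
  - by rewrite /=; ring.
  - by rewrite eq_sym (negPf neq) /=; ring.
  - by rewrite /=; ring.
have neq : inord N.-1 != inord N :> 'I_n by rewrite inord_eqE ?leq_pred //; lia.
exists (tperm (inord N.-1) (inord N)), [set inord N.-1; inord N].
rewrite cards2 neq; split=> // v k.
rewrite (rep_refl rr) dotC dot_alD iN ltnn /alD iN ltnn !mxE !andbT !inE.
case: tpermP => [->|->|/eqP/negPf-> /eqP/negPf->]; rewrite ?eqxx ?(negPf neq).
- by rewrite /=; ring.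
- by rewrite eq_sym (negPf neq) /=; ring.
- by rewrite /=; ring.
Qed.

Lemma even_addset p D E : ~~ odd #|E| -> ~~ odd #|D| ->
  ~~ odd #|[set k | (k \in E) (+) (p k \in D)]|.
Proof.
move=> evE evD; have -> : [set k | (k \in E) (+) (p k \in D)] =
    (E :\: p @^-1: D) :|: (p @^-1: D :\: E).
  by apply/setP=> k; rewrite !inE; case: (k \in E); case: (p k \in D).
have cD : #|p @^-1: D| = #|D|.
  by apply: on_card_preimset; apply: onW_bij; exists p^-1%g; [apply: permK|apply: permKV].
have disj : [disjoint E :\: p @^-1: D & p @^-1: D :\: E].
  by apply/pred0P=> k /=; rewrite !inE; case: (k \in E); case: (p k \in D).
have := cardsUI (E :\: p @^-1: D) (p @^-1: D :\: E).
rewrite (eqP (_ : _ :&: _ == set0)) ?setI_eq0 // cards0 addn0 => ->.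
have := cardsID (p @^-1: D) E; have := cardsID E (p @^-1: D); rewrite cD setIC => e1 e2.
by move: evE evD; rewrite -e1 -e2 !oddD; case: (odd _); case: (odd _); case: (odd _).
Qed.

Lemma acts_as_ex w : exists p E, acts_as w p E /\ ~~ odd #|E|.
Proof.
elim/(gen_cox_ind rr): w => [|w i [p [E [wpE evE]]]].
  exists 1%g, set0; rewrite cards0; split=> // v k.
  by rewrite (rep1 rr) mul1mx inE mul1r perm1.
have [q [D [iqD evD]]] := acts_as_refl i.
exists (p * q)%g, [set k | (k \in E) (+) (p k \in D)]; split.
  move=> v k; rewrite (rr_M rr) -mulmxA wpE iqD permM inE mulrA.
  by case: (k \in E); case: (p k \in D); rewrite /= ?mul1r ?mulrNN ?mulr1.
exact: even_addset.
Qed.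

(** A strictly dominant vector; its coordinates being distinct and positive, its
  image determines a signed permutation. *)
Definition regD : 'cV[rat]_n := \col_k (n - k)%:R.

Lemma regDE (k : 'I_n) : regD k 0 = (n - k)%:R. Proof. by rewrite mxE. Qed.

Lemma regD_gt0 (k : 'I_n) : 0 < regD k 0.
Proof. by rewrite regDE ltr0n subn_gt0. Qed.

Lemma ltr_regD (j k : 'I_n) : (regD j 0 < regD k 0) = (k < j)%N.
Proof. by rewrite !regDE ltr_nat; have := ltn_ord j; have := ltn_ord k; clear; lia. Qed.

Lemma regD_inj (j k : 'I_n) : regD j 0 = regD k 0 -> j = k.
Proof.
rewrite !regDE => /eqP; rewrite eqr_nat => /eqP e; apply: val_inj => /=.
by rewrite -(subKn (ltnW (ltn_ord j))) e subKn // ltnW.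
Qed.

Lemma regD_strict i : 0 < dot regD (alD i).
Proof.
rewrite dot_alD; case: ifP => ltiN; last by rewrite addr_gt0 ?regD_gt0.
by rewrite subr_gt0 ltr_regD !inordK // ltnS ltnW.
Qed.

Lemma sign_regD_inj b c (j k : 'I_n) :
  (-1) ^+ (nat_of_bool b) * regD j 0 = (-1) ^+ (nat_of_bool c) * regD k 0 -> b = c /\ j = k.
Proof.
have h1 := regD_gt0 j; have h2 := regD_gt0 k.
case: b; case: c; rewrite ?expr1 ?expr0 ?mul1r ?mulN1r => e.
- by split=> //; apply: regD_inj; rewrite -[LHS]opprK e opprK.
- by move: h2; rewrite -e oppr_gt0 => /(lt_trans h1); rewrite ltxx.
- by move: h1; rewrite e oppr_gt0 => /(lt_trans h2); rewrite ltxx.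
by split=> //; apply: regD_inj.
Qed.

(** Dominance makes the coordinates decrease and forces all but the last one to be
  positive; an even number of signs then leaves none. *)
Lemma dominant_regD p E (v : 'cV_n) : ~~ odd #|E| ->
  (forall k, v k 0 = (-1) ^+ (k \in E) * regD (p k) 0) -> dominant (@alD N) v ->
  p = 1%g /\ E = set0.
Proof.
move=> evE vE /forallP dv.
have v_dec (a : nat) : (a < N)%N -> v (inord a.+1) 0 <= v (inord a) 0.
  move=> aN; have := dv (inord a); rewrite dot_alD inordK ?aN ?subr_ge0 //.
  exact: ltnW.
have v_last : 0 <= v (inord N.-1) 0 + v (inord N) 0.
  by have := dv (inord N); rewrite dot_alD inordK // ltnn.
have NNE : N.-1.+1 = N by lia.
have vN1 : 0 < v (inord N.-1) 0.
  have := v_dec N.-1; rewrite NNE => /(_ (leqnn _)) h.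
  have : v (inord N.-1) 0 != 0 by rewrite vE mulf_neq0 ?signr_eq0 // gt_eqF ?regD_gt0.
  have : v (inord N) 0 != 0 by rewrite vE mulf_neq0 ?signr_eq0 // gt_eqF ?regD_gt0.
  by move: h v_last => h1 h2 /eqP h3 /eqP h4; lra.
have v_anti a b : (a <= b)%N -> (b <= N)%N -> v (inord b) 0 <= v (inord a) 0.
  move=> /subnKC <-; elim: (b - a)%N => [|d IHd]; first by rewrite addn0.
  by rewrite addnS => ltN; apply: le_trans (IHd (ltnW ltN)); apply: v_dec.
have v_gt0 a : (a < N)%N -> 0 < v (inord a) 0.
  by move=> aN; apply: lt_le_trans vN1 _; rewrite v_anti ?leq_pred // -ltnS NNE.
have nE a : (a < N)%N -> inord a \notin E.
  move=> aN; have := v_gt0 a aN; rewrite vE; case: (_ \in E) => //=.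
  by rewrite mulN1r oppr_gt0 => /(lt_trans (regD_gt0 _)); rewrite ltxx.
have E0 : E = set0.
  apply/eqP; rewrite -cards_eq0; have : E \subset [set inord N].
    apply/subsetP=> k kE; rewrite inE; apply: contraTT kE => neq.
    rewrite -[k]inord_val; apply: nE; have := ltn_ord k; rewrite ltnS leq_eqVlt.
    by case/orP=> // /eqP kN; rewrite -[k]inord_val kN eqxx in neq.
  by move/subset_leq_card; rewrite cards1; case: #|E| evE => [|[]].
split=> //; apply: perm_mono_id => i j lt_ij; rewrite ltn_neqAle.
rewrite (inj_eq val_inj) (inj_eq perm_inj) neq_ltn lt_ij /= leqNgt -ltr_regD -leNgt.
have := v_anti i j (ltnW lt_ij); rewrite -ltnS ltn_ord !inord_val => /(_ isT).
by rewrite !vE E0 !inE !mul1r.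
Qed.

(** Let [v] be the image of [regD] under the wanted signed permutation. Some [w0]
  brings [v] to a dominant vector, again an even signed permutation of [regD],
  hence equal to [regD]. So [w0^-1] sends [regD] to [v], and a signed
  permutation is determined by the image of [regD]. *)
Lemma acts_as_exists p E : ~~ odd #|E| -> exists w, acts_as w p E.
Proof.
move=> evE; pose v : 'cV[rat]_n := \col_k ((-1) ^+ (k \in E) * regD (p k) 0).
have [w0 dw0] := dominant_exists rr v.
have [q [D [w0D evD]]] := acts_as_ex w0.
have vE k : (M w0 *m v) k 0 =
    (-1) ^+ (k \in [set k | (k \in D) (+) (q k \in E)]) * regD ((q * p)%g k) 0.
  rewrite w0D mxE mulrA permM inE.
  by case: (k \in D); case: (q k \in E); rewrite /= ?mul1r ?mulrNN ?mulr1.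
have [|qp1 DE0] := dominant_regD _ vE dw0; first exact: even_addset.
have w0v : M w0 *m v = regD by apply/colP=> k; rewrite vE qp1 DE0 inE perm1 mul1r.
have [p' [E' [w0'E _]]] := acts_as_ex w0^-1%g.
exists w0^-1%g => u k; rewrite w0'E.
have := w0'E regD k; rewrite -w0v (repVK rr) w0v mxE.
by case/sign_regD_inj=> -> ->.
Qed.

Lemma acts_as_entry w p E k j : acts_as w p E -> M w k j = (-1) ^+ (k \in E) * (p k == j)%:R.
Proof.
move=> wpE; have := wpE (delta_mx j 0) k; rewrite -colE !mxE => ->.
by rewrite eqxx andbT.
Qed.

Lemma rowp_acts_as w p E k : acts_as w p E ->
  rowp (row k (M w)) = (-1) ^+ (k \in E) *: 'X^(p k).
Proof.
move=> wpE; rewrite -rowp_delta -[RHS]linearZ; congr rowp; apply/rowP=> j.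
by rewrite !mxE (acts_as_entry _ _ wpE) eqxx eq_sym.
Qed.

(** The descents of a signed permutation are comparisons between these values, see
  [asc_sreg]. *)
Definition sreg E (k : 'I_n) : rat := (-1) ^+ (k \in E) * regD k 0.

Lemma dot_regD_evec w p E (a : nat) : acts_as w p E ->
  dot regD (M w *m evec N a) = sreg E (p^-1%g (inord a)).
Proof.
move=> wpE; have evE k : evec N a k 0 = (k == inord a)%:R by rewrite mxE eqxx andbT.
rewrite dotE (bigD1 (p^-1 (inord a))%g) //= wpE permKV evE eqxx mulr1 big1 => [|k nk].
  by rewrite addr0 mulrC.
rewrite wpE evE; case: eqP => [e|_]; last by rewrite !mulr0.
by rewrite -e permK eqxx in nk.
Qed.

Lemma asc_sreg w p E (i : 'I_n) : acts_as w p E -> asc w i =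
  if (i < N)%N then sreg E (p^-1%g (inord i.+1)) < sreg E (p^-1%g i)
  else 0 < sreg E (p^-1%g (inord N.-1)) + sreg E (p^-1%g (inord N)).
Proof.
move=> wpE; rewrite (asc_strict rr _ _ regD_strict) /alD.
case: ifP => _; rewrite ?mulmxBr ?mulmxDr dotDr ?dotNr !(dot_regD_evec _ wpE) //.
by rewrite subr_gt0 inord_val.
Qed.

(** * The orbit of a half-spin weight *)

Definition Iplus : {set 'I_n} := ~: [set ord_max].

Lemma lam_setC1 (i : 'I_n) : lam (~: [set i]) = omD i.
Proof.
rewrite /lam (bigD1 i) ?inE ?eqxx //= big1 ?addr0 // => j; rewrite !inE negbK.
by case/andP=> ->.
Qed.

Lemma acts_as_lam_plus w p E k : acts_as w p E ->
  (M w *m lam Iplus) k 0 = (-1) ^+ (k \in E) / 2.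
Proof.
by move=> wpE; rewrite wpE lam_setC1 mxE /= ltnn ltnNge leqnSn /= mul1r.
Qed.

Definition negs w : {set 'I_n} := [set k | (M w *m lam Iplus) k 0 < 0].

Lemma acts_as_negs w p E : acts_as w p E -> negs w = E.
Proof.
move=> wpE; apply/setP=> k; rewrite inE (acts_as_lam_plus _ wpE).
by case: (k \in E); rewrite ?expr1 ?expr0.
Qed.

Lemma negs_inj : {in Xs Iplus &, injective negs}.
Proof.
move=> u u' Xu Xu' e; apply: (Xs_inj rr Xu Xu'); apply/colP=> k.
have [p [E [uE _]]] := acts_as_ex u; have [p' [E' [u'E _]]] := acts_as_ex u'.
by rewrite (acts_as_lam_plus _ uE) (acts_as_lam_plus _ u'E) -(acts_as_negs uE) e (acts_as_negs u'E).
Qed.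

(** The orbit consists of the vectors with coordinates [± 1/2] and an even number
  of minus signs. *)
Lemma negs_image : negs @: Xs Iplus = [set E : {set 'I_n} | ~~ odd #|E|].
Proof.
apply/setP=> E; rewrite inE; apply/imsetP/idP=> [[u Xu ->]|evE].
  by have [p [D [uD evD]]] := acts_as_ex u; rewrite (acts_as_negs uD).
have [w wE] := acts_as_exists 1%g evE.
have [Xr er] := coset_repP rr Iplus w.
exists (coset_rep s M (@omD N) Iplus w) => //.
by rewrite -(acts_as_negs wE) /negs er.
Qed.

Lemma plus_decreasing w p E : w \in Xs Iplus -> acts_as w p E ->
  forall a b : 'I_n, (a < b)%N -> sreg E (p^-1%g b) < sreg E (p^-1%g a).
Proof.
move=> /XsP Xw wpE a b lt_ab.
have step c : (c < N)%N -> sreg E (p^-1%g (inord c.+1)) < sreg E (p^-1%g (inord c)).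
  move=> cN; have ci : (inord c : 'I_n) = c :> nat by rewrite inordK // ltnW.
  have := Xw (inord c); rewrite (asc_sreg _ wpE) ci cN; apply.
  by rewrite !inE -val_eqE /= ci neq_ltn cN.
rewrite -[b]inord_val -[in X in _ < X](inord_val a) -(subnKC lt_ab).
have : (a.+1 + (b - a.+1) <= N)%N by rewrite subnKC // -ltnS.
elim: (b - a.+1)%N => [|d IHd]; first by rewrite addn0; apply: step.
by rewrite addnS => ltN; apply: lt_trans (IHd (ltnW ltN)); apply: step.
Qed.

Lemma plus_lt w p E : w \in Xs Iplus -> acts_as w p E ->
  forall k q, (p q < p k)%N = (sreg E k < sreg E q).
Proof.
move=> Xw wpE k q; have dec := plus_decreasing Xw wpE.
case: (ltngtP (p q) (p k)) => [/dec|/dec|/val_inj/perm_inj->]; rewrite ?permK ?ltxx //.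
by move=> h; rewrite ltNge (ltW h).
Qed.

Lemma card_ord_lt (k : 'I_n) : #|[set q : 'I_n | (q < k)%N]| = k.
Proof.
rewrite -sum1dep_card -(big_mkord (fun q => q < k)%N (fun=> 1%N)) big_mkcond /=.
rewrite (big_cat_nat (n := k)) //=; last exact: ltnW.
rewrite (eq_big_nat _ _ (F2 := fun=> 1%N)) => [|q /andP[_ ->]//].
rewrite sum_nat_const_nat subn0 muln1 big_nat big1 ?addn0 // => q /andP[le_kq _].
by rewrite ltnNge le_kq.
Qed.

(** An element of [Xs Iplus] sorts the values [sreg E] in decreasing order: the
  positive coordinates come first, in their order, and the negative ones follow
  in reverse order. *)
Lemma plus_position w p E k : w \in Xs Iplus -> acts_as w p E ->
  (p k = (k \in E) * (N - k) + #|[set q : 'I_n | (q < k)%N & q \notin E]| :> nat)%N.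
Proof.
move=> Xw wpE.
have -> : p k = #|[set q | sreg E k < sreg E q]| :> nat.
  rewrite -[LHS]card_ord_lt; have pbij : bijective p by exists p^-1%g; [apply: permK|apply: permKV].
  rewrite -(on_card_preimset (onW_bij _ pbij)); apply: eq_card => q; rewrite !inE.
  exact: plus_lt Xw wpE k q.
have leE (q : 'I_n) : (q <= k)%N = (q == k) || (q < k)%N by rewrite -val_eqE leq_eqVlt.
have reg0 (q : 'I_n) : 0 < regD q 0 by apply: regD_gt0.
case: (boolP (k \in E)) => kE; rewrite ?mul0n ?mul1n ?add0n.
  have -> : [set q | sreg E k < sreg E q] = ~: [set q : 'I_n | (q <= k)%N & q \in E].
    apply/setP=> q; rewrite !inE /sreg kE expr1 mulN1r negb_and -ltnNge.
    case: (q \in E); rewrite ?expr1 ?expr0 ?mulN1r ?mul1r ?orbF ?orbT.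
      by rewrite ltrN2 ltr_regD.
    by rewrite (lt_trans _ (reg0 q)) // oppr_lt0.
  have := cardsC [set q : 'I_n | (q <= k)%N & q \in E]; rewrite card_ord.
  have := cardsID E [set q : 'I_n | (q <= k)%N].
  have -> : [set q : 'I_n | (q <= k)%N] = k |: [set q : 'I_n | (q < k)%N].
    by apply/setP=> q; rewrite !inE leE.
  rewrite cardsU1 inE ltnn card_ord_lt add1n.
  have -> : (k |: [set q : 'I_n | (q < k)%N]) :&: E = [set q : 'I_n | (q <= k)%N & q \in E].
    by apply/setP=> q; rewrite !inE leE.
  have -> : (k |: [set q : 'I_n | (q < k)%N]) :\: E = [set q : 'I_n | (q < k)%N & q \notin E].
    apply/setP=> q; rewrite !inE; case: (q =P k) => [->|_]; first by rewrite kE ltnn.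
    by rewrite orFb andbC.
  move=> h1 h2; apply: (@addnI #|[set q : 'I_n | (q <= k)%N & q \in E]|).
  by rewrite h2 addnCA h1 addnS subnK // -ltnS.
apply: eq_card => q; rewrite !inE /sreg (negPf kE) expr0 mul1r.
case: (q \in E); rewrite ?expr1 ?expr0 ?mulN1r ?mul1r ?andbF ?andbT; last by rewrite ltr_regD.
by apply/negP=> /(lt_trans (reg0 k)); rewrite oppr_gt0 => /(lt_trans (reg0 q)); rewrite ltxx.
Qed.

(** The monomial contributed to row [k] by the element with sign vector [E]. *)
Definition sweight k E : {poly rat} :=
  (-1) ^+ (k \in E) *: 'X^((k \in E) * (N - k) + #|[set q : 'I_n | (q < k)%N & q \notin E]|).

Lemma rowp_plus_sum k :
  rowp (row k (galg_mx (xs Iplus))) = \sum_(E : {set 'I_n} | ~~ odd #|E|) sweight k E.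
Proof.
have -> : \sum_(E : {set 'I_n} | ~~ odd #|E|) sweight k E = \sum_(u in Xs Iplus) sweight k (negs u).
  by rewrite -(big_imset _ negs_inj) negs_image; apply: eq_bigl => E; rewrite inE.
rewrite galg_mx_xs linear_sum linear_sum; apply: eq_bigr => u Xu /=.
have [p [E [uE _]]] := acts_as_ex u.
by rewrite (rowp_acts_as k uE) (plus_position k Xu uE) (acts_as_negs uE).
Qed.

Lemma sweight_prod k E : sweight k E = \prod_(q : 'I_n)
  (if q \in E then if q == k then - 'X^(N - k) else 1 else if (q < k)%N then 'X else 1).
Proof.
rewrite (bigID (fun q : 'I_n => q < k)%N) /=.
have -> : \prod_(q : 'I_n | (q < k)%N) (if q \in E then if q == k then - 'X^(N - k) else 1
    else if (q < k)%N then 'X else 1) = 'X^#|[set q : 'I_n | (q < k)%N & q \notin E]| :> {poly rat}.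
  rewrite -prodr_const [RHS]big_mkcond [LHS]big_mkcond; apply: eq_bigr => q _; rewrite inE.
  case: ltnP => //= lt_qk; case: (q \in E) => //=.
  by case: eqP => // e; rewrite e ltnn in lt_qk.
rewrite (bigD1 k) ?ltnn //= eqxx big1 => [|q /andP[/negPf-> /negPf->]]; last by case: ifP.
rewrite mulr1 /sweight exprD; case: (k \in E); rewrite ?mul0n ?mul1n ?expr0 ?expr1.
  by rewrite scaleN1r mulrN mulrC.
by rewrite scale1r mulr1 mul1r.
Qed.

(** The weight is a product of factors depending on one sign each, so its sum over
  all sign vectors is a product of sums. *)
Lemma sum_sweight k : \sum_(E : {set 'I_n}) sweight k E =
  (1 + 'X) ^+ k * (1 - 'X^(N - k)) * 2 ^+ (N - k).
Proof.
under eq_bigr do rewrite sweight_prod; rewrite -bigA_distr.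
pose F q : {poly rat} := if (q < k)%N then 1 + 'X else if q == k then 1 - 'X^(N - k) else 2.
transitivity (\prod_(q < n) F q).
  by apply: eq_bigr => q _; rewrite /F -val_eqE /=; case: ltngtP => //= _; rewrite addrC.
have kN := ltn_ord k; rewrite -(big_mkord xpredT F) (big_cat_nat (n := k)) //=; last exact: ltnW.
rewrite -mulrA; congr (_ * _).
  rewrite (eq_big_nat _ _ (F2 := fun=> 1 + 'X)) => [|q /andP[_ lt_qk]]; last by rewrite /F lt_qk.
  by rewrite prodr_const_nat subn0.
rewrite big_ltn // {1}/F ltnn eqxx; congr (_ * _).
rewrite (eq_big_nat _ _ (F2 := fun=> 2)) => [|q /andP[lt_kq _]].
  by rewrite prodr_const_nat subSS.
by rewrite /F ltnNge (ltnW lt_kq) gtn_eqF.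
Qed.

Definition toggle E : {set 'I_n} := [set q | (q \in E) (+) (q == ord_max)].

Lemma toggleK : involutive toggle.
Proof. by move=> E; apply/setP=> q; rewrite !inE addbK. Qed.

Lemma odd_toggle E : odd #|toggle E| = ~~ odd #|E|.
Proof.
have [maxE|nmaxE] := boolP (ord_max \in E).
  have -> : toggle E = E :\ ord_max.
    apply/setP=> q; rewrite !inE; case: eqP => [->|_]; first by rewrite maxE.
    by rewrite addbF.
  by rewrite (cardsD1 ord_max E) maxE /= negbK.
have -> : toggle E = ord_max |: E.
  apply/setP=> q; rewrite !inE; case: eqP => [->|_]; first by rewrite (negPf nmaxE).
  by rewrite addbF.
by rewrite cardsU1 nmaxE.
Qed.

(** For rows other than the last one the sign of the last coordinate is free,
  so the even sign vectors carry half of the full sum. *)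
Lemma rowp_plus (k : 'I_n) : (k < N)%N -> rowp (row k (galg_mx (xs Iplus))) *+ 2 =
  (1 + 'X) ^+ k * (1 - 'X^(N - k)) * 2 ^+ (N - k).
Proof.
move=> kN; rewrite -sum_sweight rowp_plus_sum mulr2n [RHS](bigID (fun E => ~~ odd #|E|)) /=.
congr (_ + _); rewrite [RHS](reindex_inj (can_inj toggleK)).
apply: eq_big => [E|E _]; first by rewrite odd_toggle negbK.
have tE (q : 'I_n) : (q <= k)%N -> (q \in toggle E) = (q \in E).
  by move=> le_qk; rewrite inE -val_eqE /= ltn_eqF ?addbF // (leq_ltn_trans le_qk).
rewrite /sweight tE //; congr (_ *: 'X^(_ + _)); apply: eq_card => q; rewrite !inE.
by case: ltnP => //= lt_qk; have := tE q (ltnW lt_qk); rewrite inE => ->.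
Qed.

(** The rows of [galg_mx (xs Iplus)] given by [rowp_plus], combined with the
  binomial coefficients of [yv m], add up to half of
  [(1 + X)^(N - m) ((X - 1)^m - (1 - X)^m)], that is to
  [(1 + X)^(N - m) (X - 1)^m] for odd [m]. Expanding [1 + X] as
  [2 X - (X - 1)] turns this into a combination of the polynomials of the
  [yv (m + i)]. *)
Lemma yv_plus m : (m <= N)%N -> odd m ->
  yv m *m galg_mx (xs Iplus) =
  \sum_(i < (N - m).+1) ((-1) ^+ i * 'C(N - m, i)%:R * 2 ^+ (N - m - i))
     *: (yv (m + i) + last_row).
Proof.
move=> le_mN odd_m; apply: rowp_inj; rewrite rowp_mul [RHS]linear_sum.
have two_inj : injective (fun P : {poly rat} => P *+ 2).
  move=> P Q /(congr1 (fun R => (1 / 2 : rat) *: R)).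
  by rewrite -!scaler_nat !scalerA divfK // !scale1r.
apply: two_inj => /=.
transitivity ((1 + 'X) ^+ (N - m) * ('X - 1) ^+ m *+ 2 : {poly rat}).
  rewrite -sumrMnl (reindex_inj rev_ord_inj) /=.
  transitivity (\sum_(i < n) ((-1) ^+ i * 'C(m, i)%:R) * ((1 + 'X) ^+ (N - i) * 2 ^+ i)
     - \sum_(i < n) ((-1) ^+ i * 'C(m, i)%:R) * ((1 + 'X) ^+ (N - i) * (2 * 'X) ^+ i) : {poly rat}).
    rewrite -sumrB; apply: eq_bigr => i _; rewrite mxE /= subSS.
    have iN := ltn_ord i; rewrite ltnS in iN; rewrite subKn // scalerMnr.
    case: (posnP i) => [->|i_gt0].
      by rewrite subn0 ltnn scale0r !expr0 !mulr1 subrr.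
    have ltN : (N - i < N)%N by lia.
    rewrite ltN rowp_plus /= ?subSS // subKn // -mul_polyC.
    by rewrite rmorphM /= rmorphXn /= rmorphN1 rmorph_nat exprMn; ring.
  rewrite !binomial_hom // -mulrBr.
  have -> : 1 + 'X - 2 = 'X - 1 :> {poly rat} by ring.
  have -> : 1 + 'X - 2 * 'X = - ('X - 1) :> {poly rat} by ring.
  by rewrite [(- _) ^+ m]exprNn -signr_odd odd_m expr1 mulN1r opprK -mulr2n mulrnAr.
congr (_ *+ 2).
have {1}-> : 1 + 'X = 2 * 'X - ('X - 1) :> {poly rat} by ring.
rewrite exprBn mulr_suml; apply: eq_bigr => i _; rewrite linearZ /= rowp_yv; last first.
  by have := ltn_ord i; lia.
have -> : (N - (m + i) = N - m - i)%N by lia.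
rewrite -mul_polyC !rmorphM /= !rmorphXn /= rmorphN1 !rmorph_nat exprMn exprD -mulr_natr.
by ring.
Qed.

(** * The orbit of the vector weight *)

Definition Ieta : {set 'I_n} := ~: [set ord0].

Lemma lam_eta : lam Ieta = delta_mx ord0 0.
Proof.
by rewrite lam_setC1; apply/colP=> k; rewrite !mxE /= N2 leqn0 andbT.
Qed.

Lemma sreg_norm E (k : 'I_n) : `|sreg E k| = regD k 0.
Proof. by rewrite /sreg normrM normr_sign mul1r gtr0_norm ?regD_gt0. Qed.

(** Apart from the coordinate [p^-1 0], which is free, an element of [Xs Ieta]
  keeps the order of the coordinates; only the last of them may change sign. *)
Lemma eta_chain w p E : w \in Xs Ieta -> acts_as w p E -> forall a : nat, (0 < a < N)%N ->
  `|sreg E (p^-1%g (inord a.+1))| < sreg E (p^-1%g (inord a)).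
Proof.
move=> /XsP Xw wpE.
have asc_a (a : nat) : (0 < a)%N -> (a <= N)%N -> asc w (inord a).
  by move=> a0 aN; apply: Xw; rewrite !inE -val_eqE /= inordK // gtn_eqF.
have step (a : nat) : (0 < a < N)%N ->
    sreg E (p^-1%g (inord a.+1)) < sreg E (p^-1%g (inord a)).
  case/andP=> a0 aN; have := asc_a a a0 (ltnW aN).
  by rewrite (asc_sreg _ wpE) inordK ?aN // ltnW.
have last_step : `|sreg E (p^-1%g (inord N))| < sreg E (p^-1%g (inord N.-1)).
  have N1 : (0 < N.-1 < N)%N by lia.
  have := step _ N1; have NN : N.-1.+1 = N by lia.
  rewrite NN ltr_norml => ->; rewrite andbT -subr_gt0 opprK addrC.
  by have := asc_a N (ltnW N2) (leqnn N); rewrite (asc_sreg _ wpE) inordK // ltnn.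
move=> a /andP[a0 aN].
have pos_a (b : nat) : (0 < b < N)%N -> 0 < sreg E (p^-1%g (inord b)).
  case/andP=> b0 bN; have [d def_d] : exists d, (b + d = N.-1)%N by exists (N.-1 - b)%N; lia.
  elim: d b b0 bN def_d => [|d IHd] b b0 bN def_d.
    by rewrite -[b]addn0 def_d; apply: le_lt_trans last_step.
  have bN' : (b.+1 < N)%N by rewrite -(ltn_predK bN) ltnS -def_d addnS ltnS leq_addr.
  by apply: lt_trans (IHd b.+1 _ bN' _) (step _ _) => //; rewrite ?b0 ?bN // -def_d addnS.
have [ltaN|leNa] := ltnP a.+1 N.
  by rewrite gtr0_norm ?step ?a0 // pos_a.
have -> : a = N.-1 by lia.
by have -> : N.-1.+1 = N by lia.
Qed.

Lemma eta_decreasing w p E : w \in Xs Ieta -> acts_as w p E ->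
  forall a b : 'I_n, (0 < a < b)%N -> (p^-1%g a < p^-1%g b)%N.
Proof.
move=> Xw wpE a b /andP[a0 lt_ab]; rewrite -ltr_regD -!(sreg_norm E).
have step c : (0 < c < N)%N ->
    `|sreg E (p^-1%g (inord c.+1))| < `|sreg E (p^-1%g (inord c))|.
  by move=> cN; apply: lt_le_trans (eta_chain Xw wpE cN) (ler_norm _).
rewrite -[b]inord_val -[in X in _ < X](inord_val a) -(subnKC lt_ab).
have : (a.+1 + (b - a.+1) <= N)%N by rewrite subnKC // -ltnS.
elim: (b - a.+1)%N => [|d IHd] ltN.
  by rewrite addn0 in ltN *; apply: step; rewrite a0.
rewrite addnS in ltN *; apply: lt_trans (IHd (ltnW ltN)); apply: step.
by rewrite ltN addSn.
Qed.

Lemma eta_position w p E k : w \in Xs Ieta -> acts_as w p E -> k != p^-1%g ord0 ->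
  p k = (k + (k < p^-1%g ord0))%N :> nat.
Proof.
move=> Xw wpE nk; set K := p^-1%g ord0 in nk *.
have pK : p K = ord0 by rewrite permKV.
have p_gt0 q : q != K -> (0 < p q)%N.
  move=> nq; rewrite lt0n; apply: contra nq => /eqP pq0.
  by rewrite -(inj_eq (@perm_inj _ p)) pK -val_eqE /= pq0.
have lt_p q : q != K -> (p q < p k)%N = (q < k)%N.
  move=> nq; have dec := eta_decreasing Xw wpE.
  case: (ltngtP (p q) (p k)) => [lt|lt|/val_inj/perm_inj->]; last by rewrite ltnn.
    by have := dec _ _ (introT andP (conj (p_gt0 q nq) lt)); rewrite !permK => ->.
  have := dec _ _ (introT andP (conj (p_gt0 k nk) lt)); rewrite !permK => kq.
  by rewrite ltnNge (ltnW kq).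
have pbij : bijective p by exists p^-1%g; [apply: permK|apply: permKV].
rewrite -[LHS]card_ord_lt -(on_card_preimset (onW_bij _ pbij)).
rewrite (cardsD1 K) !inE pK p_gt0 //.
have -> : p @^-1: [set q : 'I_n | (q < p k)%N] :\ K = [set q : 'I_n | (q < k)%N] :\ K.
  by apply/setP=> q; rewrite !inE; case: eqP => //= /eqP/lt_p.
have e := card_ord_lt k; rewrite (cardsD1 K) inE in e; have := nk; rewrite -val_eqE /=.
by move: e; case: (ltngtP K k) => //= _ e _; rewrite ?addn0 // addn1 -[in RHS]e.
Qed.

Lemma eta_entry w p E (k j : 'I_n) : w \in Xs Ieta -> acts_as w p E -> (0 < j < N)%N ->
  M w k j = ((j == k.+1 :> nat) && (k < p^-1%g ord0)%N || (j == k) && (p^-1%g ord0 < k)%N)%:R.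
Proof.
move=> Xw wpE /andP[j0 jN]; rewrite (acts_as_entry _ _ wpE).
have -> : (-1) ^+ (k \in E) * (p k == j)%:R = (p k == j)%:R :> rat.
  case: eqP => [pk|]; last by rewrite mulr0.
  have jN' : (0 < j < N)%N by rewrite j0.
  have := eta_chain Xw wpE jN'; rewrite inord_val -pk permK => h.
  have := le_lt_trans (normr_ge0 _) h; rewrite /sreg; case: (k \in E); last by rewrite mul1r.
  by rewrite expr1 mulN1r oppr_gt0 => /(lt_trans (regD_gt0 _)); rewrite ltxx.
congr (_%:R : rat); congr nat_of_bool; have [->|nk] := eqVneq k (p^-1%g ord0).
  by rewrite ltnn !andbF permKV -val_eqE /= ltn_eqF.
rewrite -val_eqE /= (eta_position Xw wpE nk); have := nk; rewrite -!val_eqE /=.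
by case: (ltngtP k (p^-1%g ord0)) => //= _ _; rewrite ?addn1 ?addn0 ?andbT ?andbF ?orbF eq_sym.
Qed.

(** The orbit of [lam Ieta] consists of the [± e_c]; the two elements over [e_c]
  and [- e_c] are grouped together. *)
Definition eta_fiber (c : 'I_n) : {set gT} := [set u in Xs Ieta | (M u *m lam Ieta) c 0 != 0].

Lemma acts_as_lam_eta w p E k : acts_as w p E ->
  (M w *m lam Ieta) k 0 = (-1) ^+ (k \in E) * (k == p^-1%g ord0)%:R.
Proof.
move=> wpE; rewrite wpE lam_eta mxE eqxx andbT.
by rewrite -[k == _](inj_eq (@perm_inj _ p)) permKV.
Qed.

Lemma mem_eta_fiber w p E c : w \in Xs Ieta -> acts_as w p E ->
  (w \in eta_fiber c) = (c == p^-1%g ord0).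
Proof.
move=> Xw wpE; rewrite in_set Xw (acts_as_lam_eta _ wpE) mulf_eq0 signr_eq0.
by case: (c == _); rewrite ?oner_eq0 ?eqxx.
Qed.

Lemma eta_fiberE c : exists u1 u2, [/\ eta_fiber c = [set u1; u2],
  M u1 *m lam Ieta = delta_mx c 0, M u2 *m lam Ieta = - delta_mx c 0 & u1 != u2].
Proof.
(* A second coordinate, whose sign keeps the number of signs even. *)
pose d : 'I_n := if c == ord0 then ord_max else ord0.
have dc : c != d.
  by rewrite /d; have [c0|//] := eqVneq c ord0; rewrite c0 -val_eqE /= ltn_eqF // ltnW.
have ev0 : ~~ odd #|(set0 : {set 'I_n})| by rewrite cards0.
have ev2 : ~~ odd #|[set c; d]| by rewrite cards2 dc.
have [w1 w1E] := acts_as_exists (tperm c ord0) ev0.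
have [w2 w2E] := acts_as_exists (tperm c ord0) ev2.
have lam1 : M w1 *m lam Ieta = delta_mx c 0.
  apply/colP=> k; rewrite (acts_as_lam_eta _ w1E) tpermV tpermR inE mul1r mxE eqxx andbT //.
have lam2 : M w2 *m lam Ieta = - delta_mx c 0.
  apply/colP=> k; rewrite (acts_as_lam_eta _ w2E) tpermV tpermR !mxE eqxx andbT !inE.
  by case: eqP => _; rewrite ?mulr0 ?oppr0 //= expr1 mulr1.
have [X1 e1] := coset_repP rr Ieta w1; have [X2 e2] := coset_repP rr Ieta w2.
rewrite lam1 in e1; rewrite lam2 in e2.
exists (coset_rep s M (@omD N) Ieta w1), (coset_rep s M (@omD N) Ieta w2); split=> //.
  apply/setP=> u; apply/idP/set2P=> [|[->|->]]; first last.
  - by rewrite in_set X2 e2 !mxE !eqxx oppr_eq0 oner_eq0.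
  - by rewrite in_set X1 e1 !mxE !eqxx oner_eq0.
  rewrite in_set => /andP[Xu]; have [p [E [uE _]]] := acts_as_ex u.
  rewrite (acts_as_lam_eta _ uE) mulf_eq0 signr_eq0 pnatr_eq0 eqb0 negbK => /eqP def_c.
  have lam_u : M u *m lam Ieta = (-1) ^+ (c \in E) *: delta_mx c 0.
    apply/colP=> k; rewrite (acts_as_lam_eta _ uE) !mxE eqxx andbT -def_c.
    by case: eqP => [->|_]; rewrite ?mulr0.
  case: (c \in E) lam_u => lam_u; [right|left]; apply: (Xs_inj rr Xu) => //; rewrite lam_u.
    by rewrite e2 expr1 scaleN1r.
  by rewrite e1 scale1r.
apply: contraTneq isT => e12; have /colP/(_ c) : delta_mx c 0 = - delta_mx c 0 :> 'cV[rat]_n.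
  by rewrite -[LHS]e1 e12 e2.
by rewrite !mxE !eqxx.
Qed.

Lemma sum_eta (F : 'I_n -> rat) (G : gT -> rat) :
  (forall w p E, w \in Xs Ieta -> acts_as w p E -> G w = F (p^-1%g ord0)) ->
  \sum_(w in Xs Ieta) G w = 2 * \sum_c F c.
Proof.
move=> GF; transitivity (\sum_c \sum_(w in eta_fiber c) G w).
  rewrite (exchange_big_dep (mem (Xs Ieta))) /= => [|c w _]; last by rewrite in_set => /andP[].
  apply: eq_bigr => w Xw; have [p [E [wE _]]] := acts_as_ex w.
  rewrite (big_pred1 (p^-1%g ord0)) // => c /=; exact: mem_eta_fiber Xw wE.
rewrite mulr_sumr; apply: eq_bigr => c _; have [u1 [u2 [fE _ _ neq12]]] := eta_fiberE c.
transitivity (\sum_(w in eta_fiber c) F c).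
  apply: eq_bigr => w wc; have Xw : w \in Xs Ieta by move: wc; rewrite in_set => /andP[].
  have [p [E [wE _]]] := acts_as_ex w.
  by rewrite (GF _ _ _ Xw wE); move: wc; rewrite (mem_eta_fiber _ Xw wE) => /eqP <-.
by rewrite sumr_const fE cards2 neq12 mulr_natl.
Qed.

Lemma mx_eta_mid (k j : 'I_n) : (0 < j < N)%N ->
  galg_mx (xs Ieta) k j = 2 * ((j == k.+1 :> nat)%:R * (N - k)%:R + (j == k)%:R * k%:R).
Proof.
move=> jN; rewrite galg_mx_xs summxE.
rewrite (@sum_eta (fun c : 'I_n => ((j == k.+1 :> nat) && (k < c)%N || (j == k) && (c < k)%N)%:R)).
  congr (_ * _); transitivity
    (\sum_(c < n) ((j == k.+1 :> nat)%:R * (k < c)%N%:R + (j == k)%:R * (c < k)%N%:R : rat)).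
    apply: eq_bigr => c _; rewrite -!natrM -natrD; congr (_%:R).
    by case: (j == k.+1 :> nat); case: (j == k); case: ltngtP.
  have card_lt : \sum_(c < n) (c < k)%N%:R = k%:R :> rat.
    by rewrite -natr_sum -[in RHS](card_ord_lt k) -sum1dep_card [in RHS]big_mkcond.
  have card_gt : \sum_(c < n) (k < c)%N%:R = (N - k)%:R :> rat.
    rewrite -natr_sum; congr (_%:R).
    have : (\sum_(c < n) (k < c) + \sum_(c < n) (c < k) + \sum_(c < n) (c == k) = n)%N.
      rewrite -!big_split /= -[RHS]card_ord -sum1_card; apply: eq_bigr => c _.
      by rewrite -val_eqE /=; case: ltngtP.
    have -> : (\sum_(c < n) (c < k) = k)%N.
      by rewrite -[in RHS](card_ord_lt k) -sum1dep_card [in RHS]big_mkcond.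
    have -> : (\sum_(c < n) (c == k) = 1)%N by rewrite (bigD1 k) //= eqxx big1 // => c /negPf->.
    by rewrite addnAC addn1 => -[e]; rewrite -[LHS](addnK k) e.
  by rewrite big_split /= -!mulr_sumr card_lt card_gt.
by move=> w p E Xw wE; apply: eta_entry.
Qed.

Lemma mx_eta_col0 (k : 'I_n) : galg_mx (xs Ieta) k ord0 = 0.
Proof.
rewrite galg_mx_xs summxE.
have eM w : M w k ord0 = (M w *m lam Ieta) k 0 by rewrite lam_eta -colE mxE.
rewrite (bigID (fun w => w \in eta_fiber k)) /= addrC big1 ?add0r => [|w /andP[Xw]]; last first.
  by rewrite in_set Xw eM negbK => /eqP.
have [u1 [u2 [fE e1 e2 neq12]]] := eta_fiberE k.
have sub u : u \in eta_fiber k -> u \in Xs Ieta by rewrite in_set => /andP[].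
rewrite (eq_bigl (mem [set u1; u2])) => [|u]; last first.
  by rewrite -fE /=; case: (boolP (u \in eta_fiber k)) => [/sub->|]; rewrite ?andbF.
by rewrite big_setU1 ?inE //= big_set1 !eM e1 e2 !mxE !eqxx subrr.
Qed.

(** Right multiplication by the element negating the first and the last
  coordinate permutes [Xs Ieta]. *)
Lemma mx_eta_col_last (k : 'I_n) : galg_mx (xs Ieta) k ord_max = 0.
Proof.
have neq0 : ord0 != ord_max :> 'I_n by rewrite -val_eqE /= ltn_eqF // ltnW.
have ev : ~~ odd #|[set (ord0 : 'I_n); ord_max]| by rewrite cards2 neq0.
have [d dE] := acts_as_exists 1%g ev.
have dd : (d * d = 1)%g.
  apply: (rep_inj rr); rewrite (rr_M rr) (rep1 rr); apply: eq_mulmx_cV => v.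
  by apply/colP=> i; rewrite -mulmxA !dE !perm1 mul1mx mulrA -expr2 sqrr_sign mul1r.
have X_d u : u \in Xs Ieta -> (u * d)%g \in Xs Ieta.
  move=> Xu; apply/XsP=> i; rewrite !inE => i0.
  have [p [E [uE evE]]] := acts_as_ex u.
  have udE : acts_as (u * d)%g p [set k | (k \in E) (+) (p k \in [set ord0; ord_max])].
    move=> v q; rewrite (rr_M rr) -mulmxA uE dE perm1 mulrA [in RHS]inE.
    by case: (q \in E); case: (p q \in _); rewrite /= ?mul1r ?mulrNN ?mulr1.
  have sregE (c : 'I_n) : sreg [set k | (k \in E) (+) (p k \in [set ord0; ord_max])] (p^-1%g c)
      = (-1) ^+ (c \in [set ord0; ord_max]) * sreg E (p^-1%g c).
    rewrite /sreg inE permKV.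
    by case: (_ \in E); case: (c \in _); rewrite /= ?mul1r ?mulN1r ?mulrNN ?mulr1 ?opprK.
  have notmax (a : nat) : (0 < a < N)%N -> (inord a : 'I_n) \in [set ord0; ord_max] = false.
    move=> /andP[a0 aN]; rewrite !inE -!val_eqE /= inordK; last exact: ltnW.
    by rewrite gtn_eqF // ltn_eqF.
  have ismax : (inord N : 'I_n) \in [set ord0; ord_max].
    by rewrite !inE -!val_eqE /= inordK // eqxx orbT.
  have i_gt0 : (0 < i)%N by rewrite lt0n; move: i0; rewrite -val_eqE.
  have := ltn_ord i; rewrite ltnS leq_eqVlt => /orP[/eqP iN|iN].
    rewrite (asc_sreg _ udE) iN ltnn !sregE ismax notmax; last by lia.
    have := @eta_chain u p E Xu uE N.-1; have -> : N.-1.+1 = N by lia.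
    rewrite expr0 expr1 mul1r mulN1r subr_gt0 => /(_ _)/(le_lt_trans (ler_norm _)); apply.
    by lia.
  rewrite (asc_sreg _ udE) iN !sregE.
  have := @eta_chain u p E Xu uE i; rewrite i_gt0 iN inord_val => /(_ isT) h.
  have -> : i \in [set ord0; ord_max] = false by rewrite -[i]inord_val notmax // i_gt0.
  rewrite mul1r; apply: le_lt_trans h; case: (_ \in [set _; _]); last by rewrite mul1r ler_norm.
  by rewrite expr1 mulN1r -normrN ler_norm.
have X_dE u : ((u * d)%g \in Xs Ieta) = (u \in Xs Ieta).
  by apply/idP/idP=> /X_d //; rewrite -mulgA dd mulg1.
have : galg_mx (xs Ieta) k ord_max = - galg_mx (xs Ieta) k ord_max.
  rewrite galg_mx_xs summxE [LHS](reindex_inj (mulIg d)) /= (eq_bigl _ _ X_dE) -sumrN.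
  apply: eq_bigr => u _; rewrite (rr_M rr).
  have -> : (M u *m M d) k ord_max = (M u *m (M d *m delta_mx ord_max 0)) k (0 : 'I_1).
    by rewrite mulmxA -colE [RHS]mxE.
  have -> : M d *m delta_mx ord_max 0 = - delta_mx ord_max (0 : 'I_1) :> 'cV[rat]_n.
    apply/colP=> i; rewrite dE perm1 !mxE eqxx andbT.
    by case: eqP => [->|_]; rewrite ?mulr0 ?oppr0 // !inE eqxx orbT.
  by rewrite mulmxN mxE -colE mxE.
by move/eqP; rewrite -addr_eq0 -mulr2n mulrn_eq0 /= => /eqP.
Qed.

Lemma last_row_eta : last_row *m galg_mx (xs Ieta) = 0.
Proof.
apply/rowP=> j; rewrite -rowE !mxE; have := leq_ord j; rewrite leq_eqVlt => /orP[/eqP jN|jN].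
  by have -> : j = ord_max; [apply: val_inj | rewrite mx_eta_col_last].
have [j0|j_gt0] := posnP j.
  by have -> : j = ord0; [apply: val_inj | rewrite mx_eta_col0].
rewrite mx_eta_mid ?j_gt0 // subnn mulr0 -val_eqE /= [j == _ :> nat]ltn_eqF // mul0r addr0.
by rewrite mulr0.
Qed.

(** Away from the extreme columns, which vanish, [galg_mx (xs Ieta)] acts on
  polynomials by [P |-> 2 X (N P - (X - 1) P')], and
  [X^(N - m) (X - 1)^m] is an eigenvector of this operator. *)
Lemma yv_eta m : (m <= N)%N ->
  yv m *m galg_mx (xs Ieta) = (2 * (N - m))%:R *: yv m.
Proof.
move=> le_mN; apply/rowP=> j; rewrite [LHS]mxE.
have := leq_ord j; rewrite leq_eqVlt => /orP[/eqP jN|jN].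
  have -> : j = ord_max by apply: val_inj.
  rewrite big1 => [|k _]; last by rewrite mx_eta_col_last mulr0.
  by rewrite !mxE ltnn mulr0.
have [j0|j_gt0] := posnP j.
  have -> : j = ord0 by apply: val_inj.
  rewrite big1 => [|k _]; last by rewrite mx_eta_col0 mulr0.
  rewrite !mxE /= (ltnW N2) subn0; move: le_mN; rewrite leq_eqVlt => /orP[/eqP->|lt_mN].
    by rewrite subnn muln0 mul0r.
  by rewrite bin_small // mulr0 mulr0.
have lt_j1 : (j.-1 < n)%N by lia.
transitivity (2 * (yv m 0 (Ordinal lt_j1) * (N - j.-1)%:R + yv m 0 j * j%:R)).
  rewrite (eq_bigr (fun k => 2 * (yv m 0 k * ((j == k.+1 :> nat)%:R * (N - k)%:R)
      + yv m 0 k * ((j == k)%:R * k%:R)))) => [|k _]; last first.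
    by rewrite mx_eta_mid ?j_gt0 // mulrCA mulrDr.
  rewrite -mulr_sumr big_split /=; congr (_ * (_ + _)).
    rewrite (bigD1 (Ordinal lt_j1)) //= prednK // eqxx mul1r big1 ?addr0 // => k.
    rewrite -val_eqE /= => nk; have -> : (j == k.+1 :> nat) = false by lia.
    by rewrite mul0r mulr0.
  rewrite (bigD1 j) //= eqxx mul1r big1 ?addr0 // => k; rewrite eq_sym => /negPf->.
  by rewrite mul0r mulr0.
rewrite !mxE /= jN; have -> : (j.-1 < N)%N by lia.
have e1 : (N - j.-1 = (N - j).+1)%N by lia.
have := mul_bin_left m (N - j); rewrite e1; set i := (N - j)%N => e2.
have ej : j%:R = N%:R - i%:R :> rat by rewrite -natrB ?leq_subr // subKn // ltnW.
have e3 : i.+1%:R * 'C(m, i.+1)%:R = (m%:R - i%:R) * 'C(m, i)%:R :> rat.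
  rewrite -natrM e2 natrM; have [le_im|lt_mi] := leqP i m; first by rewrite natrB.
  by rewrite bin_small // !mulr0.
clearbody i; rewrite ej natrM natrB // exprS.
transitivity (2 * ((-1) ^+ i * (- (i.+1%:R * 'C(m, i.+1)%:R) + 'C(m, i)%:R * (N%:R - i%:R))) : rat).
  by ring.
by rewrite e3; ring.
Qed.

(** * Long products in the radical *)

Let eta : group_algebra rat gT := xs Ieta.
Let xplus : group_algebra rat gT := xs Iplus.

Lemma mem_xs I : xs I \in A.
Proof. by rewrite (descent_algebra_xspan rr) mem_xspan. Qed.

Lemma descent_algebra_mul a b : a \in A -> b \in A -> a * b \in A.
Proof. by move=> aA bA; apply: (subvP (descent_algebraM rr)); apply: memv_mul. Qed.

(** Exceeds all the integral eigenvalues of [eta] that occur. *)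
Let bound := (#|gT| + N.*2).+1.

(** Up to a scalar, the projection onto the [t]-eigenspace of [eta]. *)
Definition sep (t : nat) : group_algebra rat gT :=
  \prod_(i < bound | i != t :> nat) (eta - (i%:R : rat) *: 1).

Definition sep_val (t : nat) (c : rat) : rat := \prod_(i < bound | i != t :> nat) (c - i%:R).

Lemma sep_val_eq0 t c : (c < bound)%N -> c != t -> sep_val t c%:R = 0.
Proof.
by move=> cB ct; rewrite /sep_val (bigD1 (Ordinal cB)) //= subrr mul0r.
Qed.

Lemma sep_val_neq0 t : sep_val t t%:R != 0.
Proof.
by apply/prodf_neq0 => i it; rewrite subr_eq0 eqr_nat eq_sym.
Qed.

Lemma chi_sep J t : sep t \in A /\ chi J (sep t) = sep_val t (chi J eta).
Proof.
rewrite /sep /sep_val; elim/big_rec2: _ => [|i a b _ [bA chib]].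
  by split; [apply: descent_algebra1 rr | apply: chi1 rr J].
have eA : eta - (i%:R : rat) *: 1 \in A.
  by rewrite rpredB ?rpredZ ?mem_xs //; apply: descent_algebra1 rr.
split; first exact: descent_algebra_mul.
rewrite (chiM rr) // chib; congr (_ * _).
by rewrite [LHS]linearB; congr (_ - _); rewrite [LHS]linearZ /= (chi1 rr) mulr1.
Qed.

Lemma sep_chi_eq0 J t t' : t != t' -> chi J (sep t) * chi J (sep t') = 0.
Proof.
move=> tt'; rewrite !(chi_sep J _).2 (chi_xsE rr); set c := #|_|.
have cB : (c < bound)%N by rewrite ltnS (leq_trans (max_card _)) ?leq_addr.
have [ct|ct] := eqVneq c t; last by rewrite sep_val_eq0 // mul0r.
by rewrite [sep_val t' _]sep_val_eq0 ?mulr0 // ct.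
Qed.

Lemma mul_row_sep (y : 'rV[rat]_n) t c : y *m galg_mx eta = c *: y ->
  y *m galg_mx (sep t) = sep_val t c *: y.
Proof.
move=> ye; rewrite /sep /sep_val; elim/big_rec2: _ => [|i a b _ IH].
  by rewrite (galg_mx1 rr) mulmx1 scale1r.
rewrite (galg_mxM rr) mulmxA [galg_mx (_ - _)]linearB /= [galg_mx (_ *: _)]linearZ /= (galg_mx1 rr).
by rewrite mulmxBr ye -scalemxAr mulmx1 -scalerBl -scalemxAl IH scalerA.
Qed.

(** The part of [xplus] leading from one eigenspace of [eta] to another. A
  character gives [eta] a single value, so it kills one of the two [sep]
  factors: [step m] is in the radical. *)
Definition step m : group_algebra rat gT :=
  sep (2 * (N - m)) * xplus * sep (2 * (N - m.+2)).

Lemma step_in_rad m : (m.+2 <= N)%N -> in_rad (step m).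
Proof.
move=> le_mN; have sA t := (chi_sep set0 t).1.
have sxA : sep (2 * (N - m)) * xplus \in A by apply: descent_algebra_mul; rewrite ?mem_xs ?sA.
rewrite /step; split=> [|J]; first by apply: descent_algebra_mul; rewrite ?sA.
rewrite !(chiM rr) ?mem_xs ?sA // mulrAC sep_chi_eq0 ?mul0r //.
by rewrite eqn_pmul2l // neq_ltn; apply/orP; right; lia.
Qed.

(** In the expansion [yv_plus] of [yv m *m galg_mx xplus] into eigenvectors of
  [eta], the factor [sep] keeps [yv m.+2], and also [last_row] when the
  eigenvalue is 0. *)
Lemma yv_step m : odd m -> (m.+2 <= N)%N -> exists c c' : rat,
  [/\ yv m *m galg_mx (step m) = c *: yv m.+2 + c' *: last_row,
      c != 0 & (m.+2 < N)%N -> c' = 0].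
Proof.
move=> odd_m le_mN; have le_m : (m <= N)%N by lia.
pose t := (2 * (N - m.+2))%N; set k := (N - m)%N.
pose a i : rat := (-1) ^+ i * 'C(k, i)%:R * 2 ^+ (k - i).
pose c0 := sep_val (2 * k) (2 * k)%:R.
have lt2k : (2 < k.+1)%N by rewrite /k; lia.
have wE : last_row *m galg_mx (sep t) = sep_val t 0 *: last_row.
  by apply: mul_row_sep; rewrite last_row_eta scale0r.
exists (c0 * (a 2%N * sep_val t t%:R)), (c0 * \sum_(i < k.+1) a i * sep_val t 0); split.
- rewrite /step !(galg_mxM rr) !mulmxA (mul_row_sep _ (yv_eta le_m)) -/c0 -!scalemxAl.
  rewrite (yv_plus le_m odd_m) -/k -/t.
  rewrite -[X in _ = X + _]scalerA -[X in _ = _ + X]scalerA -scalerDr; congr (_ *: _).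
  rewrite mulmx_suml (eq_bigr (fun i : 'I_k.+1 =>
    a i *: (yv (m + i) *m galg_mx (sep t)) +
    (a i * sep_val t 0) *: last_row)) => [|i _]; last first.
    by rewrite -scalemxAl mulmxDl wE scalerDr scalerA.
  rewrite big_split /= -scaler_suml; congr (_ + _).
  rewrite (bigD1 (Ordinal lt2k)) //= big1 ?addr0 => [|i ni].
    have le2 : (m + 2 <= N)%N by lia.
    by rewrite (mul_row_sep _ (yv_eta le2)) addn2 -/t scalerA.
  have lei : (m + i <= N)%N by have := ltn_ord i; rewrite /k; lia.
  rewrite (mul_row_sep _ (yv_eta lei)) sep_val_eq0 ?scale0r ?scaler0 //.
    by rewrite /bound ltnS mul2n (leq_trans _ (leq_addl _ _)) // leq_double leq_subr.
  rewrite /t eqn_pmul2l //; apply: contra ni => /eqP e; rewrite -val_eqE /=; apply/eqP.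
  by move: e lei le_mN; clear; lia.
- rewrite !mulf_neq0 ?sep_val_neq0 ?signr_eq0 ?pnatr_eq0 ?expf_neq0 //.
  by rewrite -lt0n bin_gt0.
- move=> lt_mN; have t0 : (0 < t)%N by rewrite /t muln_gt0 subn_gt0.
  rewrite (_ : sep_val t 0 = 0); first by rewrite big1 ?mulr0 // => i _; rewrite mulr0.
  by apply: (@sep_val_eq0 t 0%N); rewrite // neq_ltn t0.
Qed.

Lemma yv_chain k : (k.*2.+1 <= N)%N -> exists c c' : rat,
  [/\ yv 1 *m galg_mx (\prod_(i < k) step i.*2.+1) = c *: yv k.*2.+1 + c' *: last_row,
      c != 0 & (k.*2.+1 < N)%N -> c' = 0].
Proof.
elim: k => [|k IHk] le_kN.
  exists 1, 0; split=> //; rewrite ?oner_eq0 //.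
  by rewrite big_ord0 (galg_mx1 rr) mulmx1 scale1r scale0r addr0.
have [|c [c' [e c_neq0 c'0]]] := IHk; first by rewrite doubleS in le_kN; lia.
have [||d [d' [e' d_neq0 d'0]]] := @yv_step k.*2.+1; rewrite ?oddS ?odd_double -?doubleS //.
exists (c * d), (c * d'); split; [|by rewrite mulf_neq0|by move=> /d'0->; rewrite mulr0].
rewrite big_ord_recr /= (galg_mxM rr) mulmxA e c'0; last by rewrite doubleS in le_kN; lia.
by rewrite scale0r addr0 -scalemxAl e' scalerDr !scalerA.
Qed.

Lemma prod_step_expv k : (k.*2.+1 <= N)%N ->
  \prod_(i < k) step i.*2.+1 \in (jacobson A ^+ k)%VS.
Proof.
move=> le_kN; apply: memv_prod_expv => i; apply/(jacobsonE rr)/step_in_rad.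
by have := ltn_ord i; lia.
Qed.

Lemma expv_neq0 k a (y : 'rV[rat]_n) : a \in (jacobson A ^+ k)%VS ->
  y *m galg_mx a != 0 -> (jacobson A ^+ k != 0)%VS.
Proof.
move=> aJ; apply: contraNneq => J0; move: aJ; rewrite J0 memv0 => /eqP->.
by rewrite [galg_mx 0]linear0 mulmx0.
Qed.

Lemma jacobson_neq0_even : odd N -> (jacobson A ^+ N./2 != 0)%VS.
Proof.
move=> oddN; have eN : (N./2.*2.+1 = N)%N by have := odd_double_half N; rewrite oddN.
have le_N : (N./2.*2.+1 <= N)%N by rewrite eN.
have [c [c' [e c_neq0 _]]] := yv_chain le_N.
apply: (expv_neq0 (y := yv 1) (prod_step_expv le_N)); rewrite e eN.
apply: contraNneq c_neq0 => /rowP/(_ ord0); rewrite !mxE /= (ltnW N2) subn0 binn mulr1.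
rewrite -val_eqE /= [_ == N]ltn_eqF ?(ltnW N2) // mulr0 addr0 => /eqP.
by rewrite mulf_eq0 signr_eq0 orbF.
Qed.

Lemma opp1_exists : odd N -> exists z, M z = - 1%:M.
Proof.
move=> oddN; have evT : ~~ odd #|[set: 'I_n]| by rewrite cardsT card_ord /= oddN.
have [z zE] := acts_as_exists 1%g evT; exists z.
apply: eq_mulmx_cV => v; apply/colP=> k.
by rewrite zE perm1 inE expr1 mulN1r mulNmx mul1mx mxE.
Qed.

(** * Odd rank *)

Section OddRank.
Hypothesis evenN : ~~ odd N.

Definition Iminus : {set 'I_n} := ~: [set inord N.-1].
Let xminus := xs Iminus.

(** Changing all signs but the last one is an even sign change in odd rank; up to
  sign it exchanges the last two simple roots, hence [Iplus] and [Iminus]. *)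
Lemma flip_exists : exists v, acts_as v 1%g (~: [set ord_max]).
Proof.
apply: acts_as_exists; have := cardsC [set ord_max : 'I_n].
by rewrite cards1 card_ord add1n => -[->].
Qed.

Lemma flip_alD v i : acts_as v 1%g (~: [set ord_max]) ->
  - (M v *m alD i) = alD (tperm (inord N.-1) ord_max i).
Proof.
move=> vE; have vev (a : nat) : (a < N)%N -> M v *m evec N a = - evec N a.
  move=> aN; apply/colP=> k; rewrite vE perm1 !mxE eqxx andbT !inE.
  case: (k =P inord a) => [->|_]; rewrite ?mulr0 ?oppr0 //.
  by rewrite -val_eqE /= inordK ?ltn_eqF ?expr1 ?mulr1 // ltnW.
have vN : M v *m evec N N = evec N N.
  apply/colP=> k; rewrite vE perm1 !mxE eqxx andbT !inE.
  case: (k =P inord N) => [->|_]; rewrite ?mulr0 //.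
  by rewrite -val_eqE /= inordK // eqxx mul1r.
have lt1 : (N.-1 < N)%N by lia.
have NN : N.-1.+1 = N by lia.
have i1 : (inord N.-1 : 'I_n) = N.-1 :> nat by rewrite inordK // ltnW.
case: tpermP => [->|->|/eqP n1 /eqP nN].
- rewrite /alD i1 lt1 /= ltnn NN mulmxBr vN vev // opprB opprK addrC //.
- by rewrite /alD /= i1 ltnn lt1 NN mulmxDr vN vev // opprD opprK.
have iN : (i < N.-1)%N.
  have := ltn_ord i; move: n1 nN; rewrite -!val_eqE /= i1 => /eqP n1 /eqP nN; lia.
have iN' : (i < N)%N by lia.
have iN'' : (i.+1 < N)%N by lia.
by rewrite /alD iN' mulmxBr !vev // opprB opprK addrC.
Qed.

Lemma asc_flip v u i : acts_as v 1%g (~: [set ord_max]) ->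
  asc (v * u * v^-1)%g i = asc u (tperm (inord N.-1) ord_max i).
Proof.
move=> vE; have vV : (v^-1 = v)%g.
  apply: (mulgI v); rewrite mulgV; apply: (rep_inj rr); rewrite (rr_M rr) (rep1 rr).
  apply: eq_mulmx_cV => x; apply/colP=> k; rewrite -mulmxA !vE !perm1 mul1mx mulrA.
  by rewrite -expr2 sqrr_sign mul1r.
have dv x y : dot (M v *m x) y = dot x (M v *m y) by rewrite (dot_repl rr) vV.
pose l := - (M v *m regD).
have l_gt0 j : 0 < dot l (alD j).
  by rewrite dotNl dv -dotNr (flip_alD _ vE) regD_strict.
rewrite (asc_strict rr _ _ l_gt0) (asc_strict rr _ _ regD_strict) -(flip_alD _ vE).
by rewrite vV !(rr_M rr) -!mulmxA mulmxN /l dotNl dotNr (dot_rep rr).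
Qed.

(** Conjugation by the sign change permutes the descents, hence maps the class of
  [Iplus] to that of [Iminus]. *)
Lemma mx_minus v : acts_as v 1%g (~: [set ord_max]) ->
  galg_mx xminus = M v *m galg_mx xplus *m M v^-1%g.
Proof.
move=> vE; rewrite !galg_mx_xs mulmx_sumr mulmx_suml.
rewrite (reindex_inj (conjg_inj v^-1%g)) /=; apply: eq_big => u; last first.
  by move=> _; rewrite conjgE invgK mulgA !(rr_M rr).
rewrite conjgE invgK mulgA; apply/XsP/XsP=> h i.
  rewrite !inE => iN; have := h (tperm (inord N.-1) ord_max i).
  rewrite (asc_flip _ _ vE) tpermK; apply; rewrite !inE.
  by apply: contra iN => /eqP e; rewrite -[i](tpermK (inord N.-1) ord_max) e tpermL.
rewrite !inE (asc_flip _ _ vE) => iN; apply: h; rewrite !inE.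
by apply: contra iN => /eqP e; rewrite -[i](tpermK (inord N.-1) ord_max) e tpermR.
Qed.

Lemma lam_flip v : acts_as v 1%g (~: [set ord_max]) -> M v *m lam Iplus = - lam Iminus.
Proof.
move=> vE; have i1 : (inord N.-1 : 'I_n) = N.-1 :> nat by rewrite inordK // ltnS leq_pred.
have lt1 : (N.-1 < N)%N by rewrite prednK ?(ltnW N2).
rewrite !lam_setC1; apply/colP=> k; rewrite vE perm1 !mxE !inE i1 lt1 /= !ltnn.
rewrite [(N.-1.+1 < N)%N]ltnNge prednK ?(ltnW N2) // leqnn [(N.+1 < N)%N]ltnNge leqnSn /=.
by rewrite -val_eqE /=; case: eqP => _; rewrite ?expr0 ?expr1 /=; field.
Qed.

Let h := xplus - xminus.

(** The orbits of the two half-spin weights are opposite. *)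
Lemma h_in_rad : in_rad h.
Proof.
have [v vE] := flip_exists; split=> [|J]; first by rewrite rpredB ?mem_xs.
by rewrite [LHS]linearB /= (chi_opp rr J (lam_flip vE)) subrr.
Qed.

Lemma mulmx_flip v (y : 'rV[rat]_n) j : acts_as v 1%g (~: [set ord_max]) ->
  (y *m M v) 0 j = (-1) ^+ (j != ord_max) * y 0 j.
Proof.
move=> vE; rewrite mxE (bigD1 j) //= big1 ?addr0 => [|k /negPf kj].
  by rewrite (acts_as_entry _ _ vE) perm1 eqxx mulr1 !inE mulrC.
by rewrite (acts_as_entry _ _ vE) perm1 kj !mulr0.
Qed.

Lemma mx_h v : acts_as v 1%g (~: [set ord_max]) ->
  galg_mx h = galg_mx xplus - M v *m galg_mx xplus *m M v.
Proof.
move=> vE; rewrite [LHS]linearB /= (mx_minus vE).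
have vV : (v^-1 = v)%g.
  apply: (mulgI v); rewrite mulgV; apply: (rep_inj rr); rewrite (rr_M rr) (rep1 rr).
  apply: eq_mulmx_cV => x; apply/colP=> k; rewrite -mulmxA !vE !perm1 mul1mx mulrA.
  by rewrite -expr2 sqrr_sign mul1r.
by rewrite vV.
Qed.

(** [yv N.-1] is an eigenvector of the sign change, with eigenvalue -1, so [h]
  doubles the last entry of its image under [xplus] and kills the others. *)
Lemma yv_h : yv N.-1 *m galg_mx h = 2 *: last_row.
Proof.
have [v vE] := flip_exists; have oddN1 : odd N.-1 by move: evenN; case: (N) N2 => //= ? _ /negbNE.
have yV : yv N.-1 *m M v = - yv N.-1.
  apply/rowP=> j; rewrite (mulmx_flip _ _ vE) !mxE; have [->|_] := eqVneq j ord_max.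
    by rewrite /= ltnn oppr0 mulr0.
  by rewrite mulN1r.
set w := yv N.-1 *m galg_mx xplus.
have w_last : w 0 ord_max = 1.
  rewrite /w (yv_plus (leq_pred N) oddN1) (_ : N - N.-1 = 1)%N; last by lia.
  rewrite !big_ord_recl big_ord0 !mxE /= ltnn eqxx /bump /= addn0 bin0 binn subn0 subnn.
  by rewrite !expr0 !expr1; ring.
rewrite (mx_h vE) mulmxBr !mulmxA yV !mulNmx opprK -/w; apply/rowP=> j.
rewrite [LHS]mxE (mulmx_flip _ _ vE) [RHS]mxE [last_row _ _]mxE eqxx /=.
have [->|_] := eqVneq j ord_max; first by rewrite w_last /= expr0; ring.
by rewrite /= expr1; ring.
Qed.

(** A constant term in the last row requires all coordinates but the last to be
  negative, which leaves a single even sign vector. *)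
Lemma plus_corner : galg_mx xplus ord_max ord0 = 1.
Proof.
pose E0 : {set 'I_n} := ~: [set ord_max].
have := coef_rowp (row ord_max (galg_mx xplus)) ord0; rewrite [RHS]mxE => <-.
rewrite rowp_plus_sum coef_sum.
have evE0 : ~~ odd #|E0|.
  by have := cardsC [set ord_max : 'I_n]; rewrite cards1 card_ord add1n => -[->].
have coefE E : (sweight ord_max E)`_(ord0 : 'I_n) =
    (-1) ^+ (ord_max \in E) * (E0 \subset E)%:R :> rat.
  rewrite /sweight coefZ coefXn subnn muln0 add0n eq_sym cards_eq0; congr (_ * _%:R).
  congr nat_of_bool; apply/eqP/subsetP=> [e q|sub].
    rewrite !inE => nq; apply: contraT => nqE; have /setP/(_ q) := e; rewrite !inE nqE andbT.
    by rewrite ltn_neqAle -[q == N :> nat]/(q == ord_max) nq -ltnS ltn_ord.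
  apply/setP=> q; rewrite !inE; apply/negbTE/negP=> /andP[ltq /negP]; apply; apply: sub.
  by rewrite !inE -val_eqE /= ltn_eqF.
rewrite (bigD1 E0) //= big1 ?addr0 => [|E /andP[evE nE]]; rewrite coefE.
  by rewrite subxx !inE eqxx expr0 mulr1.
case: (boolP (E0 \subset E)) => [sub|]; last by rewrite mulr0.
have maxE : ord_max \in E.
  apply: contraNT nE => nmax; rewrite eqEsubset sub andbT; apply/subsetP=> q qE.
  by rewrite !inE; apply: contraNneq nmax => <-.
case/negP: evE; have -> : E = setT.
  apply/setP=> q; rewrite inE; have [->|nq] := eqVneq q ord_max => //.
  by apply: (subsetP sub); rewrite !inE.
by rewrite cardsT card_ord.
Qed.

(** [last_row] is fixed by the sign change, so [h] doubles the first entry of its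
  image under [xplus], which is [plus_corner]. *)
Lemma last_row_h : last_row *m galg_mx h != 0.
Proof.
have [v vE] := flip_exists.
have lV : last_row *m M v = last_row.
  apply/rowP=> j; rewrite (mulmx_flip _ _ vE) !mxE eqxx /=.
  by case: eqP => _; rewrite ?expr0 ?mul1r ?mulr0.
apply/eqP=> /rowP/(_ ord0); rewrite (mx_h vE) mulmxBr !mulmxA lV.
set w := last_row *m galg_mx xplus.
have w0 : w 0 ord0 = 1 by rewrite /w -rowE mxE plus_corner.
rewrite [LHS]mxE [X in _ + X]mxE [RHS]mxE (mulmx_flip _ _ vE) w0.
rewrite -val_eqE /= ltn_eqF ?(ltnW N2) //= expr1 mulN1r opprK.
Qed.

(** The chain of steps ends at [yv N.-1], from which [h] can be applied twice. *)
Lemma jacobson_neq0_odd : (jacobson A ^+ N./2.+1 != 0)%VS.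
Proof.
have eN : (N./2.*2 = N)%N by have := odd_double_half N; rewrite (negPf evenN).
have eN1 : (N./2.-1.*2.+1 = N.-1)%N by rewrite -[in RHS]eN; case: (N./2) N2 eN => [|k] //; lia.
have le_N : (N./2.-1.*2.+1 <= N)%N by rewrite eN1 leq_pred.
have [c [c' [e c_neq0 c'0]]] := yv_chain le_N.
have hJ : h \in jacobson A by apply/(jacobsonE rr)/h_in_rad.
have -> : (N./2.+1 = N./2.-1 + 2)%N by case: (N./2) N2 eN => [|k]; lia.
apply: (@expv_neq0 _ ((\prod_(i < N./2.-1) step i.*2.+1) * (h * h)) (yv 1)).
  by rewrite expvD expv2 !memv_mul ?prod_step_expv.
rewrite !(galg_mxM rr) !mulmxA e c'0; last by rewrite eN1; lia.
rewrite scale0r addr0 eN1 -!scalemxAl yv_h -scalemxAl !scaler_eq0 !negb_or c_neq0 last_row_h.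
by rewrite pnatr_eq0.
Qed.

End OddRank.

End TypeD.

Local Close Scope ring_scope.

(** * The Loewy length in type D *)

Theorem corollary5p9 (n : nat) (W : finGroupType) (S : {set W}) :
  3 <= n -> coxeter_system S -> coxeter_type_D n S ->
  (~~ odd n -> loewy_length (descent_algebra S) = uphalf n) /\
  (odd n -> (n + 3)./2 <= loewy_length (descent_algebra S)).
Proof.
case: n => // N N2 coxS [s [s_inj defS ordss]].
have [M rr] := typeD_reflection_rep N2 coxS s_inj defS ordss.
have nilJ : (jacobson (descent_algebra S) ^+ N.+2 == 0)%VS.
  by rewrite defS; apply: (jacobson_nilpotent rr).
split=> [oddN|evenN].
  rewrite /= negbK in oddN.
  have eN : (uphalf N.+1 = N./2.+1)%N by rewrite uphalfE.
  have [z Mz] := opp1_exists N2 rr oddN.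
  apply/eqP; rewrite eqn_leq; apply/andP; split.
    have Ju : (jacobson (descent_algebra S) ^+ uphalf N.+1 == 0)%VS.
      by rewrite defS; apply: (jacobson_exp_uphalf rr Mz).
    by have [_ _] := loewy_length_least (isT : 0 < uphalf N.+1) Ju.
  rewrite eN; apply: (loewy_length_lt (isT : 0 < N.+2) nilJ).
  by rewrite defS; apply: (jacobson_neq0_even N2 rr).
rewrite /= in evenN; have -> : (N.+1 + 3)./2 = N./2.+2 by rewrite addn3.
apply: (loewy_length_lt (isT : 0 < N.+2) nilJ).
by rewrite defS; apply: (jacobson_neq0_odd N2 rr).
Qed.
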